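(* Let $(R,\mathfrak m)$ be a Noetherian local ring and $R^h$ its Henselization. Then $R$ is a splinter if and only if $R^h$ is a splinter.
   Context: A Noetherian ring $R$ is a \emph{splinter} if every finite ring map $R \to S$ inducing a surjection $\operatorname{Spec}(S) \to \operatorname{Spec}(R)$ has a left inverse in the category of $R$-modules. *)

(* Defs.v *)
From HB Require Import structures.
From mathcomp Require Import all_boot all_order all_algebra.
Set Implicit Arguments. Unset Strict Implicit. Unset Printing Implicit Defensive.
Import GRing.Theory.
Local Open Scope ring_scope.

Definition is_ideal (A : comPzRingType) (I : A -> Prop) : Prop :=
  [/\ I 0, (forall x y, I x -> I y -> I (x + y)) & (forall r x, I x -> I (r * x))].

Definition is_prime_ideal (A : comPzRingType) (P : A -> Prop) : Prop :=
  [/\ is_ideal P, ~ P 1 & (forall a b, P (a * b) -> P a \/ P b)].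

Definition is_maximal_ideal (A : comPzRingType) (M : A -> Prop) : Prop :=
  [/\ is_ideal M, ~ M 1 &
      (forall J : A -> Prop, is_ideal J -> ~ J 1 -> (forall x, M x -> J x) ->
         forall x, J x -> M x)].

(* x is a unit (A need not carry a unitRing structure). *)
Definition is_unit (A : comPzRingType) (x : A) : Prop := exists y, x * y = 1.

Definition finitely_generated_ideal (A : comPzRingType) (I : A -> Prop) : Prop :=
  exists s : seq A, forall x, I x <->
    exists c : seq A, x = \sum_(i < size s) c`_i * s`_i.

Definition noetherian (A : comPzRingType) : Prop :=
  forall I : A -> Prop, is_ideal I -> finitely_generated_ideal I.

Definition is_local (A : comPzRingType) : Prop :=
  exists m : A -> Prop, is_maximal_ideal m /\
    forall m' : A -> Prop, is_maximal_ideal m' -> forall x, m' x <-> m x.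

(* Local homomorphism of local rings: phi^{-1}(m_B) = m_A, i.e. reflects units. *)
Definition local_hom (A B : comPzRingType) (phi : A -> B) : Prop :=
  forall x, is_unit (phi x) -> is_unit x.

(* Henselian local ring (Stacks 04GE): the maximal ideal of a local ring is the set
   of non-units; every simple root of a monic polynomial mod m lifts to a root. *)
Definition henselian (A : comNzRingType) : Prop :=
  is_local A /\
  forall f : {poly A}, f \is monic -> forall a0 : A,
    ~ is_unit f.[a0] -> is_unit (f^`()).[a0] ->
    exists a : A, f.[a] = 0 /\ ~ is_unit (a - a0).

Definition is_henselization (A Ah : comNzRingType) (phi : {rmorphism A -> Ah}) : Prop :=
  [/\ henselian Ah, local_hom phi &
    forall (B : comNzRingType) (psi : {rmorphism A -> B}),
      henselian B -> local_hom psi ->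
      (exists theta : {rmorphism Ah -> B},
          local_hom theta /\ forall x, theta (phi x) = psi x) /\
      (forall theta1 theta2 : {rmorphism Ah -> B},
          local_hom theta1 -> (forall x, theta1 (phi x) = psi x) ->
          local_hom theta2 -> (forall x, theta2 (phi x) = psi x) ->
          forall y, theta1 y = theta2 y)].

Definition finite_map (A B : comPzRingType) (phi : {rmorphism A -> B}) : Prop :=
  exists s : seq B, forall y : B,
    exists c : seq A, y = \sum_(i < size s) phi c`_i * s`_i.

Definition spec_surjective (A B : comPzRingType) (phi : {rmorphism A -> B}) : Prop :=
  forall p : A -> Prop, is_prime_ideal p ->
    exists q : B -> Prop, is_prime_ideal q /\ forall x, p x <-> q (phi x).

Definition has_module_retraction (A B : comPzRingType) (phi : {rmorphism A -> B}) : Prop :=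
  exists g : B -> A,
    [/\ forall y z, g (y + z) = g y + g z,
        forall r y, g (phi r * y) = r * g y &
        forall r, g (phi r) = r].

Definition splinter (A : comPzRingType) : Prop :=
  forall (B : comPzRingType) (phi : {rmorphism A -> B}),
    finite_map phi -> spec_surjective phi -> has_module_retraction phi.

(* Main.v *)
Require Import Defs.
From HB Require Import structures.
From mathcomp Require Import all_boot all_order all_algebra.
From mathcomp Require Import all_field ring boolp classical_sets.
Set Implicit Arguments. Unset Strict Implicit. Unset Printing Implicit Defensive.
Import GRing.Theory.
Local Open Scope ring_scope.
Local Open Scope quotient_scope.

(** A finite cover splits iff a finite linear system over the base ring is solvable.

    Descent. A solution over [Rh] maps to every [R / J] with [J] primary to the maximal
    ideal, since [R / J] is Henselian and [Rh] has the universal property; Krull's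
    intersection theorem then gives a solution over [R].

    Ascent. By uniqueness in the universal property, [Rh] is generated from [R] by ring
    operations, inverses of units and simple roots of monic polynomials, so it is enough
    to carry the splinter property from a domain [C] to [C' = C[b]], where [b] is a
    root of a monic [g] over [C], congruent to some [b0] in [C] and with [g'(b)] a unit.
    The splinter property allows one to take for [g] the minimal polynomial of [b]. Given
    a finite cover [T] of [C'], for each root [a] of [g] in a large field the map
    [C' -> F, b |-> a] extends to [T]; the images of [T] generate a finite extension [Z]
    of [C], which admits a [C]-linear [G : Z -> C] with [G 1] a unit. With
    [h = (g - g(b0)) / (X - b0)] one has [sum_a h(a) = g'(b0)], so [G (h(a))] is a unit
    for one root [a]. Restricting [G] to [T] along that root and using that
    Hom_C(C', C) is free of rank one over [C'], one obtains a [C']-linear map [T -> C']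
    which takes a unit value at [1]. *)

(** * Quotients and subrings *)

(** No tensor product is formed. A map from the base of a cover to a field extends to the cover once
    a prime over its kernel is chosen. The images of the cover then generate, over the ring of
    interest, a finite subalgebra of a large field. That ring embeds in it, so lying over makes it a
    cover again. This works because splinters are domains.

    The rings [C[b]] need not be local, and localizing them could lose finiteness over [C]. So
    [splinter_at] only asks for a linear map whose value at 1 becomes a unit in the ambient local
    ring, and that value is inverted there at the very end.

    The minimal polynomial of [b] is available over [C] because a splinter is normal: [G 1] is a
    denominator common to all integral elements under consideration.

    Since [Rh] is given only by its universal property, relations over it are controlled up to
    nonzero multiples, which suffices in a domain. *)

Lemma rmorphism_of_fun (A B : pzRingType) (f : A -> B) :
  (forall x y, f (x + y) = f x + f y) -> (forall x y, f (x * y) = f x * f y) ->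
  f 1 = 1 -> exists g : {rmorphism A -> B}, forall x, g x = f x.
Proof.
move=> fD fM f1.
have f0 : f 0 = 0 by apply: (addrI (f 0)); rewrite -fD !addr0.
have fB : zmod_morphism f.
  move=> x y; apply/eqP; rewrite eq_sym subr_eq -fD subrK; exact/eqP.
have fm : monoid_morphism f by split.
pose g : {rmorphism A -> B} := HB.pack f
  (GRing.isZmodMorphism.Build A B f fB) (GRing.isMonoidMorphism.Build A B f fm).
by exists g.
Qed.

Lemma rmorphism_factor (A B D : pzRingType) (p : {rmorphism A -> D})
    (f : {rmorphism A -> B}) :
  (forall d, exists a, p a = d) -> (forall a, p a = 0 -> f a = 0) ->
  exists g : {rmorphism D -> B}, forall a, g (p a) = f a.
Proof.
move=> /choice [s sK] kerpf.
have fsp a : f (s (p a)) = f a.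
  apply/eqP; rewrite -subr_eq0 -rmorphB; apply/eqP/kerpf.
  by rewrite rmorphB sK subrr.
have [g gE] : exists g : {rmorphism D -> B}, forall x, g x = f (s x).
  apply: rmorphism_of_fun => [x y|x y|]; last by rewrite -(rmorph1 p) fsp rmorph1.
  - by rewrite -{1}(sK x) -{1}(sK y) -rmorphD fsp rmorphD.
  - by rewrite -{1}(sK x) -{1}(sK y) -rmorphM fsp rmorphM.
by exists g => a; rewrite gE fsp.
Qed.

Lemma ideal_opp (A : comPzRingType) (I : A -> Prop) x : is_ideal I -> I x -> I (- x).
Proof. by case=> _ _ IM Ix; rewrite -mulN1r; apply: IM. Qed.

Lemma ideal_sub (A : comPzRingType) (I : A -> Prop) x y :
  is_ideal I -> I x -> I y -> I (x - y).
Proof. by move=> II; case: (II) => _ ID _ Ix Iy; apply: ID => //; apply: ideal_opp. Qed.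

Lemma ideal_mull (A : comPzRingType) (I : A -> Prop) x y : is_ideal I -> I x -> I (x * y).
Proof. by case=> _ _ IM Ix; rewrite mulrC; apply: IM. Qed.

Lemma ideal_sum (A : comPzRingType) (I : A -> Prop) (J : Type) (r : seq J)
    (P : pred J) (F : J -> A) :
  is_ideal I -> (forall j, P j -> I (F j)) -> I (\sum_(j <- r | P j) F j).
Proof. by case=> I0 ID _ IF; elim/big_ind: _. Qed.

(** Multiplication is defined through chosen representatives. [I] may contain 1 and the quotient may
    be zero, which happens in [splinter_at_domain] when one of the two factors is a unit. *)
Lemma quotient_pz (B : comPzRingType) (I : B -> Prop) : is_ideal I ->
  exists (D : comPzRingType) (p : {rmorphism B -> D}),
    (forall d, exists a, p a = d) /\ (forall x, p x = 0 <-> I x).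
Proof.
move=> II; have [I0 _ _] := II.
pose J : {pred B} := fun x => `[< I x >].
have Jz : zmod_closed J.
  by split=> [|x y /asboolP Ix /asboolP Iy]; apply/asboolP => //; exact: ideal_sub.
pose JJ : zmodClosed B := HB.pack (J : B -> bool) (GRing.isZmodClosed.Build B J Jz).
pose D := Quotient.quot JJ; pose p : B -> D := \pi_D.
have pD x y : p (x + y) = p x + p y by rewrite /p raddfD.
have psurj d : exists a, p a = d by exists (repr d); rewrite /p reprK.
have pker x : p x = 0 <-> I x.
  rewrite -(raddf0 (\pi_D)); split.
    by move/eqP; rewrite -Quotient.idealrBE subr0 => /asboolP.
  by move=> Ix; apply/eqP; rewrite -Quotient.idealrBE subr0; apply/asboolP.
have [s sK] := choice psurj.
have p0 : p 0 = 0 by apply/pker.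
have pB x y : p (x - y) = p x - p y.
  by apply/eqP; rewrite eq_sym subr_eq -pD subrK.
have pE x y : p x = p y <-> I (x - y).
  rewrite -pker pB; split=> [->|/eqP]; first by rewrite subrr.
  by rewrite subr_eq0 => /eqP.
pose mul a b := p (s a * s b).
have pM x y : p (x * y) = mul (p x) (p y).
  apply/pE; have Ix : I (x - s (p x)) by apply/pE; rewrite sK.
  have Iy : I (y - s (p y)) by apply/pE; rewrite sK.
  rewrite -[x * y](subrK (s (p x) * y)) -mulrBl -addrA -mulrBr.
  case: II => _ ID IM; apply: ID; last exact: IM.
  by rewrite mulrC; apply: IM.
have mulA : associative mul.
  by move=> a b c; rewrite -(sK a) -(sK b) -(sK c) -!pM mulrA.
have mulC : commutative mul by move=> a b; rewrite -(sK a) -(sK b) -!pM mulrC.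
have mul1 : left_id (p 1) mul by move=> a; rewrite -(sK a) -pM mul1r.
have mulD : left_distributive mul +%R.
  by move=> a b c; rewrite -(sK a) -(sK b) -(sK c) -pD -!pM -pD mulrDl.
pose m := GRing.Zmodule_isComPzRing.Build D mulA mulC mul1 mulD.
pose D' : comPzRingType := HB.pack D m.
have [q qE] := @rmorphism_of_fun B D' p pD pM erefl.
by exists D', q; split=> [d|x]; rewrite ?qE //; have [a <-] := psurj d; exists a.
Qed.

Lemma quotient_nz (B : comPzRingType) (I : B -> Prop) : is_ideal I -> ~ I 1 ->
  exists (D : comNzRingType) (p : {rmorphism B -> D}),
    (forall d, exists a, p a = d) /\ (forall x, p x = 0 <-> I x).
Proof.
move=> II I1; have [D [p [psurj pker]]] := quotient_pz II.
have D1 : (1 : D) != 0.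
  by apply/eqP; rewrite -(rmorph1 p) => /pker.
pose D' : comNzRingType := HB.pack D
  (GRing.PzSemiRing_isNonZero.Build D D1).
by exists D', p.
Qed.

Lemma subring_type (B : comNzRingType) (S : B -> Prop) :
  S 1 -> (forall x y, S x -> S y -> S (x - y)) ->
  (forall x y, S x -> S y -> S (x * y)) ->
  exists (D : comNzRingType) (v : {rmorphism D -> B}),
    injective v /\ (forall x, S x <-> exists d, v d = x).
Proof.
move=> S1 SB SM; pose J : {pred B} := fun x => `[< S x >].
have Jz : subring_closed J.
  by split=> [|x y|x y]; rewrite ?unfold_in /J; do ?[move=> /asboolP ?]; apply/asboolP;
    auto.
pose D0 := {x : B | J x}.
pose D : comNzRingType := HB.pack D0 (GRing.SubChoice_isSubComNzRing.Build B J D0 Jz).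
have [v vE] := @rmorphism_of_fun D B (fun x : D => val (x : D0)) (fun _ _ => erefl) 
  (fun _ _ => erefl) erefl.
exists D, v; split=> [x y|x].
  by rewrite !vE => /val_inj.
split=> [Sx|[d <-]]; last by rewrite vE; apply/asboolP/(valP (d : D0)).
have Jx : J x by apply/asboolP.
by exists (Sub x Jx : D0); rewrite vE.
Qed.

(** * Prime ideals, local rings, lying over *)

Lemma exists_maximal_pred (T : Type) (P : (T -> Prop) -> Prop) (A0 : T -> Prop) :
  P A0 ->
  (forall F : (T -> Prop) -> Prop, (exists X, F X) -> (forall X, F X -> P X) ->
     (forall X Y, F X -> F Y ->
        (forall x, X x -> Y x) \/ (forall x, Y x -> X x)) ->
     P (fun x => exists X, F X /\ X x)) ->
  exists A, [/\ P A, forall x, A0 x -> A x &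
    forall B, P B -> (forall x, A x -> B x) -> forall x, B x -> A x].
Proof.
move=> PA0 Pchain.
pose P' : set (set T) := fun A => A = set0 \/ (P A /\ forall x, A0 x -> A x).
have [F FP' Ftot|A [P'A Amax]] := @Zorn_bigcup T P'.
  pose F' X := F X /\ X <> set0.
  have [[X0 F'X0]|noF'] := pselect (exists X, F' X); last first.
    left; apply/seteqP; split=> // x [X FX Xx]; apply: noF'; exists X; split=> // XE.
    by rewrite XE in Xx.
  right; have -> : (\bigcup_(X in F) X)%classic = (fun x => exists X, F' X /\ X x).
    apply/seteqP; split=> x; last by case=> X [[FX _] Xx]; exists X.
    by case=> X FX Xx; exists X; split=> //; split=> // XE; rewrite XE in Xx.
  have F'P X : F' X -> P X /\ (forall x, A0 x -> X x).
    by case=> FX nX; case: (FP' X FX).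
  split.
    apply: Pchain; first by exists X0.
    - by move=> X /F'P[].
    - by move=> X Y [FX _] [FY _]; exact: Ftot.
  by move=> x A0x; exists X0; split=> //; apply: (F'P X0 F'X0).2.
have [PA A0A] : P A /\ forall x, A0 x -> A x.
  case: P'A => [A_0|//]; rewrite A_0.
  have [A0_0|[x A0x]] : A0 = set0 \/ exists x, A0 x.
    have [?|nE] := pselect (exists x, A0 x); first by right.
    by left; apply/seteqP; split=> // x A0x; apply: nE; exists x.
    by rewrite -A0_0.
  case: (Amax A0); last by right.
  by rewrite A_0; split=> // /(_ x A0x).
exists A; split=> // B PB AB x Bx.
have [//|nAx] := pselect (A x).
case: (Amax B); last by right; split=> // y /A0A /AB.
by split=> // /(_ x Bx).
Qed.

Definition adjoin_ideal (A : comPzRingType) (Q : A -> Prop) (a : A) : A -> Prop :=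
  fun y => exists q r, Q q /\ y = q + r * a.

Lemma adjoin_idealP (A : comPzRingType) (Q : A -> Prop) (a : A) : is_ideal Q ->
  [/\ is_ideal (adjoin_ideal Q a), forall x, Q x -> adjoin_ideal Q a x &
      adjoin_ideal Q a a].
Proof.
move=> [Q0 QD QM]; split.
- split.
  + by exists 0, 0; rewrite mul0r addr0.
  + move=> _ _ [q [r [Qq ->]]] [q' [r' [Qq' ->]]]; exists (q + q'), (r + r').
    by rewrite mulrDl addrACA; split=> //; apply: QD.
  + move=> u _ [q [r [Qq ->]]]; exists (u * q), (u * r).
    by rewrite mulrDr mulrA; split=> //; apply: QM.
- by move=> x Qx; exists x, 0; rewrite mul0r addr0.
- by exists 0, 1; rewrite mul1r add0r.
Qed.

Lemma exists_maximal_ideal_avoiding (A : comPzRingType) (I S : A -> Prop) :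
  is_ideal I -> (forall x, I x -> ~ S x) ->
  exists Q, [/\ is_ideal Q, forall x, Q x -> ~ S x, forall x, I x -> Q x &
    forall J, is_ideal J -> (forall x, J x -> ~ S x) ->
      (forall x, Q x -> J x) -> forall x, J x -> Q x].
Proof.
move=> II IS.
pose P J := is_ideal J /\ forall x : A, J x -> ~ S x.
have [//|F [X0 FX0] FP Ftot|Q [[IQ QS] IQ' Qmax]] := @exists_maximal_pred A P I.
  have FI X : F X -> is_ideal X by move=> /FP[].
  split; last by move=> x [X [FX Xx]]; apply: (FP _ FX).2.
  split.
  - by exists X0; split=> //; have [] := FI _ FX0.
  - move=> x y [X [FX Xx]] [Y [FY Yy]].
    have [XY|YX] := Ftot _ _ FX FY.
      by exists Y; split=> //; have [_ YD _] := FI _ FY; apply: YD => //; apply: XY.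
    by exists X; split=> //; have [_ XD _] := FI _ FX; apply: XD => //; apply: YX.
  - by move=> r x [X [FX Xx]]; exists X; split=> //; have [_ _ XM] := FI _ FX; apply: XM.
by exists Q; split=> // J IJ JS QJ; apply: Qmax.
Qed.

Lemma exists_prime_avoiding (A : comPzRingType) (I S : A -> Prop) :
  is_ideal I -> S 1 -> (forall x y, S x -> S y -> S (x * y)) ->
  (forall x, I x -> ~ S x) ->
  exists Q, [/\ is_prime_ideal Q, forall x, I x -> Q x & forall x, Q x -> ~ S x].
Proof.
move=> II S1 SM IS.
have [Q [IQ QS IQ' Qmax]] := exists_maximal_ideal_avoiding II IS.
exists Q; split=> //; split=> // [Q1|a b Qab]; first exact: (QS 1).
have notin c : ~ Q c -> exists q r, Q q /\ S (q + r * c).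
  move=> nQc; apply: contrapT => nE; apply: nQc.
  have [IJ QJ Jc] := adjoin_idealP c IQ.
  apply: (Qmax _ IJ) => // y [q [r [Qq ->]]] Sy.
  by apply: nE; exists q, r.
have [|/notin[q [r [Qq Sq]]]] := pselect (Q a); first by left.
have [|/notin[q' [r' [Qq' Sq']]]] := pselect (Q b); first by right.
case: (QS _ _ (SM _ _ Sq Sq')).
rewrite mulrDl; case: (IQ) => _ QD QM; apply: (QD); first exact: ideal_mull.
rewrite mulrDr mulrACA; apply: (QD); first exact: (QM).
exact: QM.
Qed.

Lemma unit_mull (A : comPzRingType) (x y : A) : is_unit (x * y) -> is_unit x.
Proof. by case=> z xyz; exists (y * z); rewrite mulrA. Qed.

Lemma unit_mulr (A : comPzRingType) (x y : A) : is_unit (x * y) -> is_unit y.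
Proof. by rewrite mulrC; apply: unit_mull. Qed.

Lemma unit_mul (A : comPzRingType) (x y : A) : is_unit x -> is_unit y -> is_unit (x * y).
Proof. by move=> [u xu] [v yv]; exists (u * v); rewrite mulrACA xu yv mulr1. Qed.

Lemma unit1 (A : comPzRingType) : is_unit (1 : A).
Proof. by exists 1; rewrite mulr1. Qed.

Lemma unit_exp (A : comPzRingType) (x : A) n : is_unit x -> is_unit (x ^+ n).
Proof.
by move=> ux; elim: n => [|n IH]; [exact: unit1|rewrite exprS; apply: unit_mul].
Qed.

Lemma unit_opp (A : comPzRingType) (x : A) : is_unit x -> is_unit (- x).
Proof. by case=> y xy; exists (- y); rewrite mulrNN. Qed.

Lemma unit_rmorph (A B : comPzRingType) (f : {rmorphism A -> B}) x :
  is_unit x -> is_unit (f x).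
Proof. by case=> y xy; exists (f y); rewrite -rmorphM xy rmorph1. Qed.

Lemma unit_mulI (A : comPzRingType) (u x y : A) : is_unit u -> u * x = u * y -> x = y.
Proof.
by case=> v uv e; rewrite -[x]mul1r -[y]mul1r -uv ![u * v]mulrC -!mulrA e.
Qed.

Lemma unit_mul_eq0 (A : comPzRingType) (u x : A) : is_unit u -> u * x = 0 -> x = 0.
Proof. by move=> uu e; apply: (unit_mulI uu); rewrite mulr0. Qed.

(** Locality in terms of elements only: the nonunits are closed under addition. [is_localP]
    identifies it with [is_local]. *)
Definition units_local (A : comPzRingType) : Prop :=
  ~ is_unit (0 : A) /\ forall x y : A, is_unit (x + y) -> is_unit x \/ is_unit y.

Lemma nonunit_ideal_maximal (A : comPzRingType) (x : A) :
  ~ is_unit x -> exists M, is_maximal_ideal M /\ M x.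
Proof.
move=> nux; pose I y := exists r, y = r * x.
have II : is_ideal I.
  split=> [|_ _ [r ->] [r' ->]|u _ [r ->]]; first by exists 0; rewrite mul0r.
    by exists (r + r'); rewrite mulrDl.
  by exists (u * r); rewrite mulrA.
have IS y : I y -> y <> 1.
  by move=> [r ->] rx; apply: nux; exists r; rewrite mulrC.
have [Q [IQ QS IQ' Qmax]] := exists_maximal_ideal_avoiding II IS.
exists Q; split; last by apply: IQ'; exists 1; rewrite mul1r.
split=> // [Q1|J IJ J1 QJ]; first exact: (QS 1).
by apply: Qmax => // y Jy y1; apply: J1; rewrite -y1.
Qed.

Lemma is_localP (A : comPzRingType) : is_local A <-> units_local A.
Proof.
split=> [[m [[Im m1 mmax] muniq]]|[nu0 uD]].
  have nu_m x : ~ is_unit x -> m x.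
    by move=> /nonunit_ideal_maximal[M [MM Mx]]; apply: (muniq _ MM _).1.
  have m_nu x : m x -> ~ is_unit x.
    by move=> mx [y xy]; apply: m1; rewrite -xy; apply: ideal_mull.
  split=> [|x y uxy]; first by apply: m_nu; case: Im.
  have [|nux] := pselect (is_unit x); first by left.
  have [|nuy] := pselect (is_unit y); first by right.
  case: (m_nu (x + y)) => //; case: Im => _ mD _.
  by apply: mD; apply: nu_m.
pose m (x : A) := ~ is_unit x.
have Im : is_ideal m.
  by split=> // [x y mx my /uD[]|r x mx /unit_mulr].
have m1 : ~ m 1 by move=> /(_ (unit1 A)).
have prop_m J : is_ideal J -> ~ J 1 -> forall x, J x -> m x.
  by move=> IJ J1 x Jx [y xy]; apply: J1; rewrite -xy; apply: ideal_mull.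
exists m; split.
  by split=> // J IJ J1 _; apply: prop_m.
move=> m' [Im' m'1 m'max] x; split; first exact: prop_m.
by apply: m'max => //; apply: prop_m.
Qed.

Lemma local_sum_unit (A : comPzRingType) (J : eqType) (r : seq J) (F : J -> A) :
  units_local A -> is_unit (\sum_(j <- r) F j) -> exists2 j, j \in r & is_unit (F j).
Proof.
move=> [nu0 uD]; elim: r => [|i r IH]; first by rewrite big_nil.
rewrite big_cons => /uD[ui|/IH[j jr uj]]; first by exists i; rewrite ?mem_head.
by exists j; rewrite // in_cons jr orbT.
Qed.

Lemma local_add_unit (A : comPzRingType) (x y : A) :
  units_local A -> is_unit x -> ~ is_unit y -> is_unit (x + y).
Proof.
move=> [nu0 uD] ux nuy; have := ux; rewrite -{1}(addrK y x) => /uD[] //.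
by move=> /unit_opp; rewrite opprK.
Qed.

Lemma local_sub_unit (A : comPzRingType) (x y : A) :
  units_local A -> ~ is_unit (x - y) -> is_unit y -> is_unit x.
Proof. by move=> lA nxy uy; rewrite -(subrK y x) addrC; apply: local_add_unit. Qed.

Lemma horner_sub_dvd (A : comNzRingType) (p : {poly A}) (x y : A) :
  exists w, p.[x] - p.[y] = (x - y) * w.
Proof.
elim/poly_ind: p => [|p c [w IH]]; first by exists 0; rewrite !horner0 subrr mulr0.
exists (w * x + p.[y]); rewrite !hornerMXaddC opprD addrACA subrr addr0.
by rewrite mulrDr mulrA -IH !mulrBl mulrC [p.[y] * x]mulrC [y * p.[y]]mulrC addrA subrK.
Qed.

Lemma local_horner_sub (A : comNzRingType) (p : {poly A}) (x y : A) :
  ~ is_unit (x - y) -> ~ is_unit (p.[x] - p.[y]).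
Proof. by have [w ->] := horner_sub_dvd p x y; move=> n /unit_mull. Qed.

(** Determinant trick: the matrix [t - A] kills the column of the [s i], hence so does its
    determinant, by multiplication with the adjugate. *)
Lemma char_poly_annihilates (C B : comNzRingType) (k : {rmorphism C -> B}) n
    (A : 'M[C]_n) (s : 'I_n -> B) (t : B) :
  (forall i, t * s i = \sum_j k (A i j) * s j) ->
  forall i, (map_poly k (char_poly A)).[t] * s i = 0.
Proof.
move=> ts i; rewrite map_char_poly.
pose M := t%:M - map_mx k A; pose v := \col_j s j.
have Mv : M *m v = 0.
  rewrite mulmxBl mul_scalar_mx; apply/matrixP => j j0; rewrite !mxE ts.
  by apply/eqP; rewrite subr_eq0; apply/eqP/eq_bigr => l _; rewrite !mxE.
have detM : (char_poly (map_mx k A)).[t] = \det M.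
  rewrite -[LHS]/(horner_eval t _) /char_poly -det_map_mx; congr (\det _).
  apply/matrixP => a b; rewrite !mxE /horner_eval.
  rewrite -[LHS]/(horner _ t).
  by rewrite hornerD hornerN hornerMn hornerX hornerC.
have /matrixP/(_ i 0) : \det M *: v = 0.
  by rewrite -mul_scalar_mx -mul_adj_mx -mulmxA Mv mulmx0.
by rewrite !mxE detM.
Qed.

Lemma finite_integral (C B : comNzRingType) (k : {rmorphism C -> B}) : finite_map k ->
  forall t, exists2 p : {poly C}, p \is monic & (map_poly k p).[t] = 0.
Proof.
move=> [s sgen] t.
have /choice[c cE] (i : 'I_(size s)) : exists c : seq C,
  t * s`_i = \sum_(j < size s) k c`_j * s`_j by apply: sgen.
have := @char_poly_annihilates _ _ k _ (\matrix_(i, j) (c i)`_j) (fun i => s`_i) t.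
set p := char_poly _ => pE; exists p; first exact: char_poly_monic.
have [d dE] := sgen 1.
rewrite -[LHS]mulr1 dE mulr_sumr big1 // => i _.
rewrite mulrCA pE ?mulr0 // => j; rewrite cE.
by apply: eq_bigr => l _; rewrite mxE.
Qed.

Lemma prime_exp (A : comPzRingType) (p : A -> Prop) x n : is_prime_ideal p ->
  p (x ^+ n) -> p x.
Proof.
move=> [_ p1 pM]; elim: n => [|n IH]; first by rewrite expr0.
by rewrite exprS => /pM[].
Qed.

Lemma char_poly0 (A : comNzRingType) n : char_poly (0 : 'M[A]_n) = 'X^n.
Proof. by rewrite /char_poly /char_poly_mx map_mx0 subr0 det_scalar. Qed.

(** [I] is the extension of [p] to [B]. It contracts to [p]: if [k y] is in [I], then [y] is a root
    of the characteristic polynomial of a matrix with entries in [p], which modulo [p] is a power of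
    [X], so a power of [y] is in [p]. A prime containing [I] and avoiding the image of the
    complement of [p] then does the job. *)
Lemma lying_over (C B : comNzRingType) (k : {rmorphism C -> B}) :
  finite_map k -> injective k -> spec_surjective k.
Proof.
move=> [s sgen] kinj p pp; have [Ip p1 pM] := pp; have [p0 pD pMl] := Ip.
pose I y := exists c : 'I_(size s) -> C,
  (forall i, p (c i)) /\ y = \sum_i k (c i) * s`_i.
have II : is_ideal I.
  split.
  - by exists (fun=> 0); split=> //; rewrite big1 // => i _; rewrite rmorph0 mul0r.
  - move=> _ _ [c [pc ->]] [d [pd ->]]; exists (fun i => c i + d i); split.
      by move=> i; apply: pD.
    by rewrite -big_split; apply: eq_bigr => i _; rewrite rmorphD mulrDl.
  - move=> r _ [c [pc ->]].
    have /choice[d dE] (i : 'I_(size s)) : exists d : seq C,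
      r * s`_i = \sum_(j < size s) k d`_j * s`_j by apply: sgen.
    exists (fun j => \sum_i c i * (d i)`_j); split.
      by move=> j; apply: ideal_sum => // i _; apply: ideal_mull.
    rewrite mulr_sumr; under eq_bigr => i _ do rewrite mulrCA dE mulr_sumr.
    rewrite exchange_big; apply: eq_bigr => j _ /=.
    rewrite rmorph_sum mulr_suml; apply: eq_bigr => i _.
    by rewrite rmorphM mulrA.
have kI y : I (k y) -> p y.
  move=> Iky; have [D [q [qsurj qker]]] := quotient_nz Ip p1.
  have /choice[c cE] (i : 'I_(size s)) : exists c : 'I_(size s) -> C,
      (forall j, p (c j)) /\ k y * s`_i = \sum_j k (c j) * s`_j.
    by case: II => _ _ IM; have := IM s`_i _ Iky; rewrite mulrC.
  have := @char_poly_annihilates _ _ k _ (\matrix_(i, j) c i j) (fun i => s`_i) (k y).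
  set A := \matrix_(_, _) _; rewrite horner_map => pE.
  have A0 : (char_poly A).[y] = 0.
    apply: kinj; rewrite rmorph0; have [d dE] := sgen 1.
    rewrite -[LHS]mulr1 dE mulr_sumr big1 // => i _.
    rewrite mulrCA pE ?mulr0 // => j; rewrite (cE j).2.
    by apply: eq_bigr => l _; rewrite mxE.
  have : q (char_poly A).[y] = 0 by rewrite A0 rmorph0.
  rewrite -horner_map map_char_poly.
  have -> : map_mx q A = 0.
    by apply/matrixP => i j; rewrite !mxE; apply/qker; apply: (cE i).1.
  by rewrite char_poly0 hornerXn -rmorphXn => /qker; apply: prime_exp.
have [||||Q [pQ IQ QS]] :=
    @exists_prime_avoiding B I (fun y => exists2 c, y = k c & ~ p c).
- by [].
- by exists 1; rewrite ?rmorph1.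
- move=> _ _ [c -> npc] [d -> npd]; exists (c * d); first by rewrite rmorphM.
  by move=> /pM[].
- by move=> x Ix [c xE npc]; apply: npc; apply: kI; rewrite -xE.
exists Q; split=> // x; split=> [px|Qx].
  apply: IQ; have [d dE] := sgen (k x).
  have [e eE] := sgen 1; exists (fun i => x * e`_i); split.
    by move=> i; apply: ideal_mull.
  rewrite -[LHS]mulr1 eE mulr_sumr; apply: eq_bigr => i _.
  by rewrite rmorphM mulrA.
by apply: contrapT => npx; apply: (QS _ Qx); exists x.
Qed.

(** * Field extensions *)

Definition is_domain (A : comPzRingType) : Prop :=
  forall x y : A, x * y = 0 -> x = 0 \/ y = 0.

Lemma domain_exp (A : comNzRingType) (x : A) n : is_domain A -> x <> 0 -> x ^+ n <> 0.
Proof.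
move=> domA x0; elim: n => [|n IH]; first by rewrite expr0; apply/eqP/oner_neq0.
by rewrite exprS => /domA[].
Qed.

Lemma field_is_domain (F : fieldType) : is_domain F.
Proof. by move=> x y /eqP; rewrite mulf_eq0 => /orP[] /eqP; [left|right]. Qed.

Lemma zero_prime_ideal (A : comNzRingType) :
  is_domain A -> is_prime_ideal (fun x : A => x = 0).
Proof.
move=> domA; split=> //; first by split=> // [x y -> ->|r x ->]; rewrite ?addr0 ?mulr0.
exact/eqP/oner_neq0.
Qed.

Lemma domain_of_inj (A B : comPzRingType) (f : {rmorphism A -> B}) :
  injective f -> is_domain B -> is_domain A.
Proof.
move=> finj domB x y xy; have /domB[] : f x * f y = 0 by rewrite -rmorphM xy rmorph0.
  by rewrite -(rmorph0 f) => /finj; left.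
by rewrite -(rmorph0 f) => /finj; right.
Qed.

Lemma rmorph_injP (A B : pzRingType) (f : {rmorphism A -> B}) :
  (forall x, f x = 0 -> x = 0) -> injective f.
Proof.
move=> f0 x y fxy; apply/eqP; rewrite -subr_eq0; apply/eqP/f0.
by rewrite rmorphB fxy subrr.
Qed.

Lemma frac_embedding (A : comNzRingType) : is_domain A ->
  exists (F : fieldType) (k : {rmorphism A -> F}), injective k.
Proof.
move=> domA.
pose u : {pred A} := fun x => `[< exists y, y * x = 1 >].
have /choice[inv invE] (x : A) : exists y, if u x then y * x = 1 else y = x.
  by case: (boolP (u x)) => [/asboolP|]; [|exists x].
have mulVx : {in u, left_inverse 1 inv *%R}.
  by move=> x ux; have := invE x; have -> : u x by [].
have unitP (x y : A) : y * x = 1 -> u x by move=> yx; apply/asboolP; exists y.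
have inv_out : {in [predC u], inv =1 id}.
  by move=> x /negbTE ux; have := invE x; have -> : u x = false by [].
pose A1 : comUnitRingType := HB.pack (GRing.ComNzRing.sort A)
  (GRing.ComNzRing_hasMulInverse.Build A mulVx unitP inv_out).
have dom1 : @GRing.integral_domain_axiom A1.
  by move=> x y /domA[] ->; rewrite eqxx ?orbT.
pose A2 : idomainType := HB.pack (GRing.ComUnitRing.sort A1)
  (GRing.ComUnitRing_isIntegral.Build A1 dom1).
pose k0 : {rmorphism A2 -> {fraction A2}} := @FracField.tofrac A2.
have [k kE] := @rmorphism_of_fun A {fraction A2} k0 (rmorphD k0) (rmorphM k0) (rmorph1 k0).
exists {fraction A2}, k; apply: rmorph_injP => x; rewrite kE => /eqP.
by rewrite tofrac_eq0 => /eqP.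
Qed.

Lemma exists_irreducible_factor (F : fieldType) (p : {poly F}) : (1 < size p)%N ->
  exists q, irreducible_poly q /\ q %| p.
Proof.
have [n] := ubnP (size p); elim: n p => // n IH p; rewrite ltnS => pn p1.
have [[q [q1 qp pq]]|nE] :=
  pselect (exists q : {poly F}, [/\ size q != 1%N, q %| p & ~~ (q %= p)]); last first.
  exists p; split=> //; split=> // q q1 qp; apply: contrapT => /negP pq.
  by apply: nE; exists q.
have p0 : p != 0 by rewrite -size_poly_gt0 ltnW.
have q0 : q != 0 by apply: contraTneq qp => ->; rewrite dvd0p.
have qltp : (size q < size p)%N.
  by rewrite ltn_neqAle dvdp_leq // andbT; apply: contra pq; rewrite dvdp_size_eqp.
have [||r [ir rq]] := IH q.
- exact: leq_trans qltp pn.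
- by rewrite ltn_neqAle eq_sym q1 size_poly_gt0.
by exists r; split=> //; apply: dvdp_trans rq qp.
Qed.

Lemma exists_root_extension (F : fieldType) (p : {poly F}) : (1 < size p)%N ->
  exists (L : fieldType) (k : {rmorphism F -> L}) (x : L), root (map_poly k p) x.
Proof.
move=> /exists_irreducible_factor[q [iq qp]].
have [L _ [z qz _]] := irredp_FAdjoin iq.
exists L, (in_alg L), z; apply: root_dvdp qz; by rewrite dvdp_map.
Qed.

Lemma exists_splitting_extension (F : fieldType) (p : {poly F}) : p \is monic ->
  exists (L : fieldType) (k : {rmorphism F -> L}) (rs : seq L),
    map_poly k p = \prod_(a <- rs) ('X - a%:P).
Proof.
have [n] := ubnP (size p); elim: n F p => // n IH F p; rewrite ltnS => pn pm.
have [p1|p1] := leqP (size p) 1.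
  exists F, idfun, [::]; rewrite big_nil map_poly_id //.
  have /size_poly1P[c c0 pE] : size p == 1%N.
    by rewrite eqn_leq p1 size_poly_gt0 monic_neq0.
  by move: pm; rewrite pE monicE lead_coefC => /eqP ->.
have [L [k [x]]] := exists_root_extension p1.
have kpm : map_poly k p \is monic by rewrite map_monic.
case/factor_theorem=> q qE.
have qm : q \is monic by rewrite -(monicMr _ (monicXsubC x)) -qE.
have qn : (size q < n)%N.
  apply: leq_trans pn; rewrite -(size_map_poly k) qE size_Mmonic ?monicXsubC //.
    by rewrite size_XsubC addn2.
  exact: monic_neq0.
have [M [l [rs rsE]]] := IH _ _ qn qm.
exists M, (l \o k), (l x :: rs); rewrite big_cons map_poly_comp qE rmorphM /=.
by rewrite rsE mulrC map_polyXsubC.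
Qed.

(** Pseudo-division by a member of least size leaves a remainder in [P] that is smaller still, hence
    zero. The power of the leading coefficient is the price of dividing over a ring. *)
Lemma ideal_minimal_poly (C : comNzRingType) (P : {poly C} -> Prop) :
  is_ideal P -> (exists2 p, P p & p != 0) ->
  exists q, [/\ q != 0, P q, forall r, P r -> (size r < size q)%N -> r = 0 &
    forall r, P r -> exists m w, lead_coef q ^+ m *: r = w * q].
Proof.
move=> IP [p Pp p0].
pose Q n := `[< exists q : {poly C}, [/\ q != 0, P q & size q = n] >].
have exQ : exists n, Q n by exists (size p); apply/asboolP; exists p.
have [n /asboolP[q [q0 Pq <-]] nmin] := ex_minnP exQ.
have small r : P r -> (size r < size q)%N -> r = 0.
  move=> Pr rq; apply/eqP; case: eqVneq => // r0.
  have /nmin : Q (size r) by apply/asboolP; exists r.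
  by rewrite leqNgt rq.
exists q; split=> // r Pr.
have rE := Pdiv.ComRing.rdivp_eq q r.
exists (Pdiv.CommonRing.rscalp r q), (Pdiv.CommonRing.rdivp r q); rewrite rE.
rewrite [Pdiv.CommonRing.rmodp r q]small ?addr0 ?Pdiv.CommonRing.ltn_rmodp //.
have -> : Pdiv.CommonRing.rmodp r q =
    lead_coef q ^+ Pdiv.CommonRing.rscalp r q *: r - Pdiv.CommonRing.rdivp r q * q.
  by rewrite rE addrC addKr.
case: (IP) => _ _ PM; apply: ideal_sub => //; last exact: PM.
by rewrite -mul_polyC; apply: PM.
Qed.

Lemma kernel_is_ideal (A B : comPzRingType) (f : {rmorphism A -> B}) :
  is_ideal (fun x => f x = 0).
Proof.
split=> [|x y fx fy|r x fx]; first exact: rmorph0.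
  by rewrite rmorphD fx fy addr0.
by rewrite rmorphM fx mulr0.
Qed.

Definition eval_map (A B : comNzRingType) (f : {rmorphism A -> B}) (b : B) :
  {rmorphism {poly A} -> B} := horner_eval b \o map_poly f.

Lemma eval_mapE (A B : comNzRingType) (f : {rmorphism A -> B}) (b : B) p :
  eval_map f b p = (map_poly f p).[b].
Proof. by []. Qed.

Lemma eval_mapC (A B : comNzRingType) (f : {rmorphism A -> B}) (b : B) a :
  eval_map f b a%:P = f a.
Proof. by rewrite eval_mapE map_polyC hornerC. Qed.

Lemma eval_mapX (A B : comNzRingType) (f : {rmorphism A -> B}) (b : B) :
  eval_map f b 'X = b.
Proof. by rewrite eval_mapE map_polyX hornerX. Qed.

Lemma eval_mapZ (A B : comNzRingType) (f : {rmorphism A -> B}) (b : B) a p :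
  eval_map f b (a *: p) = f a * eval_map f b p.
Proof. by rewrite -mul_polyC rmorphM eval_mapC. Qed.

Lemma eval_map_rmorph (A B D : comNzRingType) (f : {rmorphism A -> B})
    (g : {rmorphism B -> D}) (h : {rmorphism A -> D}) b p :
  (forall a, h a = g (f a)) -> g (eval_map f b p) = eval_map h (g b) p.
Proof.
move=> hE; rewrite !eval_mapE -horner_map -map_poly_comp; congr _.[_].
by apply: eq_map_poly => a; rewrite hE.
Qed.

(** This identifies [D[t]] with [D[b]], where [b] is a root of the image of a polynomial [q] of
    least size killing [t]. Pseudo-division gives both inclusions of kernels, once a polynomial [r0]
    of least size killing [b] is known to kill [t]. *)
Lemma simple_extension_inj (D M : comNzRingType) (F : fieldType)
    (j : {rmorphism D -> M}) (psi : {rmorphism D -> F}) (t : M) (p : {poly D}) :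
  is_domain M -> injective j -> injective psi -> p \is monic -> eval_map j t p = 0 ->
  exists (L : fieldType) (k : {rmorphism F -> L}) (b : L), forall r,
    eval_map j t r = 0 <-> eval_map (k \o psi) b r = 0.
Proof.
move=> domM jinj psiinj pm pt.
have domD := domain_of_inj jinj domM.
have [q [q0 qt qmin qdiv]] := @ideal_minimal_poly D _ (kernel_is_ideal (eval_map j t))
  (ex_intro2 _ _ p pt (monic_neq0 pm)).
have q1 : (1 < size q)%N.
  rewrite ltnNge; apply/negP => /size1_polyC qE.
  move: qt q0; rewrite qE eval_mapC polyC_eq0 -(rmorph0 j) => /jinj ->.
  by rewrite eqxx.
have psiq1 : (1 < size (map_poly psi q))%N.
  by rewrite size_map_inj_poly ?rmorph0.
have [L [k [b /rootP qb]]] := exists_root_extension psiq1.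
exists L, k, b.
have kinj : injective (k \o psi).
  by apply: inj_comp => //; apply: fmorph_inj.
have {}qb : eval_map (k \o psi) b q = 0 by rewrite eval_mapE map_poly_comp.
have lead0 (C B : comNzRingType) (f : {rmorphism C -> B}) (r : {poly C}) m :
    is_domain B -> injective f -> r != 0 -> f (lead_coef r ^+ m) <> 0.
  move=> domB finj r0; rewrite rmorphXn; apply: domain_exp => //.
  rewrite -(rmorph0 f) => /finj/eqP; apply/negP; by rewrite lead_coef_eq0.
have [r0 [r00 r0b _ rdiv]] := @ideal_minimal_poly D _
  (kernel_is_ideal (eval_map (k \o psi) b)) (ex_intro2 _ _ q qb q0).
(* A multiple of [q] equals [w * r0], so [w] or [r0] kills [t]. If [w] does, it is at least as long
   as [q], which leaves only a constant for [r0]; but a nonzero constant does not kill [b]. *)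
have r0t : eval_map j t r0 = 0.
  have [m [w wE]] := rdiv q qb.
  have /domM[wt|//] : eval_map j t w * eval_map j t r0 = 0.
    by rewrite -rmorphM -wE eval_mapZ qt mulr0.
  have lqw : lead_coef r0 ^+ m * lead_coef q <> 0.
    move=> /domD[]; apply/eqP; last by rewrite lead_coef_eq0.
    have /eqP := lead0 _ _ j r0 m domM jinj r00.
    by apply: contraNneq => ->; rewrite rmorph0.
  have w0 : w != 0.
    apply/eqP => w0; apply: lqw; move: wE; rewrite w0 mul0r.
    by move/(congr1 (fun p : {poly D} => p`_(size q).-1)); rewrite coefZ coef0.
  have wr0 : lead_coef w * lead_coef r0 != 0.
    by apply/eqP => /domD[] /eqP; rewrite lead_coef_eq0; apply/negP.
  have qw : (size q <= size w)%N.
    by rewrite leqNgt; apply/negP => /(qmin w wt) /eqP; apply/negP.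
  have : size (lead_coef r0 ^+ m *: q) = (size w + size r0).-1.
    by rewrite wE size_proper_mul.
  have sq : (size (lead_coef r0 ^+ m *: q) <= size q)%N by apply: size_scale_leq.
  move=> sE; rewrite sE in sq.
  have r1 : (size r0 <= 1)%N.
    move: sq qw; case: (size r0) => [|[|n]] //; rewrite addnS /= addnS => h1 h2.
    by have := leq_ltn_trans (leq_addr n _) (leq_trans h1 h2); rewrite ltnn.
  exfalso; move: r0b r00; rewrite (size1_polyC r1) eval_mapC polyC_eq0 => e.
  by move/eqP; case; apply: kinj; rewrite e /= !rmorph0.
move=> r; split=> [rt|rb].
  have [m [w wE]] := qdiv r rt.
  have : eval_map (k \o psi) b (lead_coef q ^+ m *: r) = 0.
    by rewrite wE rmorphM qb mulr0.
  rewrite eval_mapZ => /(@field_is_domain L)[] // /(lead0 _ _ _ _ _ (@field_is_domain L) kinj q0).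
  by [].
have [m [w wE]] := rdiv r rb.
have : eval_map j t (lead_coef r0 ^+ m *: r) = 0 by rewrite wE rmorphM r0t mulr0.
by rewrite eval_mapZ => /domM[] // /(lead0 _ _ _ _ _ domM jinj r00).
Qed.

(** Dividing [D] by the common kernel of [j] and [psi] reduces to the injective case. *)
Lemma simple_extension (D M : comNzRingType) (F : fieldType)
    (j : {rmorphism D -> M}) (psi : {rmorphism D -> F}) (t : M) (p : {poly D}) :
  is_domain M -> (forall x, j x = 0 <-> psi x = 0) ->
  p \is monic -> eval_map j t p = 0 ->
  exists (L : fieldType) (k : {rmorphism F -> L}) (b : L), forall r,
    eval_map j t r = 0 <-> eval_map (k \o psi) b r = 0.
Proof.
move=> domM jpsi pm pt.
have [|D' [q [qsurj qker]]] := quotient_nz (kernel_is_ideal j).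
  by rewrite rmorph1; apply/eqP/oner_neq0.
have [j' j'E] : exists j' : {rmorphism D' -> M}, forall a, j' (q a) = j a.
  by apply: rmorphism_factor => // a /qker.
have [psi' psi'E] : exists psi' : {rmorphism D' -> F}, forall a, psi' (q a) = psi a.
  by apply: rmorphism_factor => // a /qker/jpsi.
have j'inj : injective j'.
  apply: rmorph_injP => x; have [a <-] := qsurj x.
  by rewrite j'E => /qker.
have psi'inj : injective psi'.
  apply: rmorph_injP => x; have [a <-] := qsurj x.
  by rewrite psi'E => /jpsi/qker.
have evE (L : comNzRingType) (f : {rmorphism D -> L}) (f' : {rmorphism D' -> L}) b r :
    (forall a, f' (q a) = f a) -> eval_map f b r = eval_map f' b (map_poly q r).
  by move=> fE; rewrite !eval_mapE -map_poly_comp; congr _.[_]; apply: eq_map_poly => a;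
    rewrite /= fE.
have qpm : map_poly q p \is monic by apply: monic_map.
have [|L [k [b kb]]] := simple_extension_inj domM j'inj psi'inj qpm (t := t).
  by rewrite -(evE _ j).
exists L, k, b => r; rewrite (evE _ j j') // (evE _ (k \o psi) (k \o psi')) ?kb //.
by move=> a; rewrite /= psi'E.
Qed.

(** [D'] is an iterated polynomial ring over [D]. Equality of the kernels of [j'] and [psi'] records
    that its images in [M] and in [F'] are isomorphic, so subrings of [M] never have to be
    formed. *)
Lemma extend_seq (M : comNzRingType) (s : seq M) : is_domain M ->
  forall (D : comNzRingType) (F : fieldType) (j : {rmorphism D -> M})
    (psi : {rmorphism D -> F}),
  (forall x, j x = 0 <-> psi x = 0) ->
  (forall t, t \in s -> exists2 p : {poly D}, p \is monic & eval_map j t p = 0) ->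
  exists (D' : comNzRingType) (i : {rmorphism D -> D'}) (j' : {rmorphism D' -> M})
    (F' : fieldType) (k : {rmorphism F -> F'}) (psi' : {rmorphism D' -> F'}),
    [/\ forall x, j' (i x) = j x, forall x, psi' (i x) = k (psi x),
        forall x, j' x = 0 <-> psi' x = 0 & forall t, t \in s -> exists d, j' d = t].
Proof.
move=> domM; elim: s => [|t s IH] D F j psi jpsi sint.
  by exists D, idfun, j, F, idfun, psi.
have [p pm pt] := sint t (mem_head _ _).
have [L [k [b kb]]] := simple_extension domM jpsi pm pt.
have [|u us|D' [i [j' [F' [k' [psi' [iE kE jE sE]]]]]]] :=
    IH _ _ (eval_map j t) (eval_map (k \o psi) b) => //.
  have [|r rm ru] := sint u; first by rewrite in_cons us orbT.
  exists (map_poly polyC r); first exact: monic_map.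
  rewrite !eval_mapE in ru *; rewrite -map_poly_comp -[RHS]ru; congr _.[_].
  by apply: eq_map_poly => a; exact: (eval_mapC j).
exists D', (i \o polyC), j', F', (k' \o k), psi'; split=> // [x|x|u].
- by rewrite /= iE eval_mapC.
- by rewrite /= kE eval_mapC.
- rewrite in_cons => /orP[/eqP ->|/sE//].
  by exists (i 'X); rewrite iE eval_mapX.
Qed.

(** The domain [T / Q] is integral over [C], so its generators can be matched with elements of an
    extension of [F] one after the other. *)
Lemma extend_to_finite (C : comNzRingType) (T : comPzRingType) (F : fieldType)
    (kap : {rmorphism C -> T}) (psi : {rmorphism C -> F}) (Q : T -> Prop) :
  finite_map kap -> is_prime_ideal Q -> (forall x, Q (kap x) <-> psi x = 0) ->
  exists (F' : fieldType) (k : {rmorphism F -> F'}) (iota : {rmorphism T -> F'}),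
    forall x, iota (kap x) = k (psi x).
Proof.
move=> [s sgen] [IQ Q1 QM] Qpsi.
have [M [q [qsurj qker]]] := quotient_nz IQ Q1.
have domM : is_domain M.
  move=> x y; have [a <-] := qsurj x; have [b <-] := qsurj y.
  by rewrite -rmorphM => /qker/QM[] /qker; [left|right].
pose j : {rmorphism C -> M} := q \o kap.
have jpsi x : j x = 0 <-> psi x = 0 by rewrite -Qpsi -qker.
have jgen y : exists c : seq C, y = \sum_(i < size (map q s)) j c`_i * (map q s)`_i.
  have [x <-] := qsurj y; have [c ->] := sgen x; exists c.
  rewrite size_map rmorph_sum; apply: eq_bigr => i _.
  by rewrite rmorphM (nth_map 0).
have jfin : finite_map j by exists (map q s).
have [||D' [i [j' [F' [k [psi' [iE kE jE sE]]]]]]] := @extend_seq M (map q s) domM _ _ j psi.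
- exact: jpsi.
- by move=> t _; have [p] := finite_integral jfin t; exists p.
have [g gE] : exists g : {rmorphism M -> F'}, forall d, g (j' d) = psi' d.
  apply: rmorphism_factor => [y|d /jE//].
  have [c ->] := jgen y.
  have /choice[d dE] (l : 'I_(size (map q s))) : exists d, j' d = (map q s)`_l.
    by apply: sE; apply: mem_nth.
  exists (\sum_(l < size (map q s)) i c`_l * d l).
  by rewrite rmorph_sum; apply: eq_bigr => l _; rewrite rmorphM iE dE.
exists F', k, (g \o q) => x /=.
by rewrite -[q (kap x)]/(j x) -iE gE kE.
Qed.

(** * Finite subalgebras and splinters *)

(** Same shape as the condition in [finite_map]. The list of coefficients may have any length,
    missing entries being read as 0. *)
Definition lspan (C B : comPzRingType) (k : {rmorphism C -> B}) (s : seq B) (y : B) :=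
  exists c : seq C, y = \sum_(i < size s) k c`_i * s`_i.

Lemma lspan_fun (C B : comPzRingType) (k : {rmorphism C -> B}) (s : seq B) y :
  lspan k s y <-> exists c : nat -> C, y = \sum_(i < size s) k (c i) * s`_i.
Proof.
split=> [[c ->]|[c ->]]; first by exists (fun i => c`_i).
by exists (mkseq c (size s)); apply: eq_bigr => i _; rewrite nth_mkseq.
Qed.

Lemma lspan0 (C B : comPzRingType) (k : {rmorphism C -> B}) (s : seq B) : lspan k s 0.
Proof.
by exists [::]; rewrite big1 // => i _; rewrite nth_nil rmorph0 mul0r.
Qed.

Lemma lspanD (C B : comPzRingType) (k : {rmorphism C -> B}) (s : seq B) x y :
  lspan k s x -> lspan k s y -> lspan k s (x + y).
Proof.
move=> [c ->] [d ->]; apply/lspan_fun; exists (fun i => c`_i + d`_i).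
by rewrite -big_split; apply: eq_bigr => i _; rewrite rmorphD mulrDl.
Qed.

Lemma lspanZ (C B : comPzRingType) (k : {rmorphism C -> B}) (s : seq B) a x :
  lspan k s x -> lspan k s (k a * x).
Proof.
move=> [c ->]; apply/lspan_fun; exists (fun i => a * c`_i).
by rewrite mulr_sumr; apply: eq_bigr => i _; rewrite rmorphM mulrA.
Qed.

Lemma lspanB (C B : comPzRingType) (k : {rmorphism C -> B}) (s : seq B) x y :
  lspan k s x -> lspan k s y -> lspan k s (x - y).
Proof.
move=> sx sy; apply: lspanD => //; rewrite -mulN1r -(rmorph1 k) -rmorphN.
exact: lspanZ.
Qed.

Lemma mem_lspan (C B : comPzRingType) (k : {rmorphism C -> B}) (s : seq B) x :
  x \in s -> lspan k s x.
Proof.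
move=> xs; apply/lspan_fun; exists (fun i => (i == index x s)%:R).
have xi : (index x s < size s)%N by rewrite index_mem.
rewrite (bigD1 (Ordinal xi)) //= eqxx rmorph1 mul1r nth_index // big1 ?addr0 // => i.
by rewrite -val_eqE /= => /negbTE ->; rewrite rmorph0 mul0r.
Qed.

Lemma lspan_sum (C B : comPzRingType) (k : {rmorphism C -> B}) (s : seq B) (J : Type)
    (r : seq J) (F : J -> B) :
  (forall j, lspan k s (F j)) -> lspan k s (\sum_(j <- r) F j).
Proof. by move=> sF; elim/big_ind: _ => // [|x y]; [exact: lspan0|exact: lspanD]. Qed.

Lemma lspan_ind (C B : comPzRingType) (k : {rmorphism C -> B}) (s : seq B) (U : B -> Prop) :
  U 0 -> (forall x y, U x -> U y -> U (x + y)) ->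
  (forall a x, x \in s -> U (k a * x)) -> forall y, lspan k s y -> U y.
Proof.
move=> U0 UD Us y [c ->]; elim/big_ind: _ => // i _.
by apply: Us; apply: mem_nth.
Qed.

(** Conditions on the generators alone under which their span is a subring, and therefore a
    [C]-algebra that is finite as a module. *)
Definition subalg_gen (C B : comPzRingType) (k : {rmorphism C -> B}) (s : seq B) :=
  lspan k s 1 /\ forall x y, x \in s -> y \in s -> lspan k s (x * y).

Lemma subalg_genM (C B : comPzRingType) (k : {rmorphism C -> B}) (s : seq B) x y :
  subalg_gen k s -> lspan k s x -> lspan k s y -> lspan k s (x * y).
Proof.
move=> [_ sM] + sy; move: x; apply: lspan_ind => [|x x' ? ?|a x xs].
- by rewrite mul0r; apply: lspan0.
- by rewrite mulrDl; apply: lspanD.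
rewrite -mulrA; apply: lspanZ; move: y sy; apply: lspan_ind => [|y y' ? ?|b y ys].
- by rewrite mulr0; apply: lspan0.
- by rewrite mulrDr; apply: lspanD.
by rewrite mulrCA; apply: lspanZ; apply: sM.
Qed.

Lemma subalg_genC (C B : comPzRingType) (k : {rmorphism C -> B}) (s : seq B) c :
  subalg_gen k s -> lspan k s (k c).
Proof. by case=> s1 _; rewrite -[k c]mulr1; apply: lspanZ. Qed.

Lemma subalg_type (C B : comNzRingType) (k : {rmorphism C -> B}) (s : seq B) :
  subalg_gen k s -> exists (Z : comNzRingType) (v : {rmorphism Z -> B})
    (kZ : {rmorphism C -> Z}), [/\ injective v, forall c, v (kZ c) = k c, finite_map kZ
      & forall x, lspan k s x <-> exists z, v z = x].
Proof.
move=> sg; have [s1 _] := sg.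
have [Z [v [vinj vE]]] := @subring_type B (lspan k s) s1 (@lspanB _ _ k s)
  (fun x y => @subalg_genM _ _ k s x y sg).
have /choice[f fE] (c : C) : exists z, v z = k c.
  by apply/vE; apply: subalg_genC.
have [kZ kZE] : exists kZ : {rmorphism C -> Z}, forall c, kZ c = f c.
  by apply: rmorphism_of_fun => [x y|x y|]; apply: vinj;
    rewrite ?rmorphD ?rmorphM ?rmorph1 !fE ?rmorphD ?rmorphM ?rmorph1.
exists Z, v, kZ; split=> // [c|]; first by rewrite kZE fE.
have /choice[g gE] (i : 'I_(size s)) : exists z, v z = s`_i.
  by apply/vE; apply: mem_lspan; apply: mem_nth.
exists [seq g i | i <- enum 'I_(size s)] => y.
have [c yE] : lspan k s (v y) by apply/vE; exists y.
exists c; apply: vinj; rewrite yE rmorph_sum size_map size_enum_ord.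
apply: eq_bigr => i _; rewrite rmorphM kZE fE (nth_map i) ?size_enum_ord //.
by rewrite nth_ord_enum gE.
Qed.

Lemma subalg_gen_powers (C B : comNzRingType) (k : {rmorphism C -> B}) (b : B)
    (p : {poly C}) : p \is monic -> eval_map k b p = 0 ->
  exists s, subalg_gen k s /\ forall x, lspan k s x <-> exists r, x = eval_map k b r.
Proof.
move=> pm pb; pose s := mkseq (fun i => b ^+ i) (size p).
have sE x : lspan k s x <-> exists r, x = eval_map k b r.
  split.
    move: x; apply: lspan_ind => [|_ _ [r ->] [r' ->]|a _ /mapP[i _ ->]].
    - by exists 0; rewrite rmorph0.
    - by exists (r + r'); rewrite rmorphD.
    - by exists (a *: 'X^i); rewrite eval_mapZ rmorphXn eval_mapX.
  move=> [r ->]; rewrite (Pdiv.RingMonic.rdivp_eq pm r) rmorphD rmorphM pb mulr0 add0r.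
  have := Pdiv.CommonRing.ltn_rmodpN0 r (monic_neq0 pm).
  set q := Pdiv.CommonRing.rmodp r p => qp.
  exists q; rewrite eval_mapE size_mkseq (horner_coef_wide _ (n := size p)).
    by apply: eq_bigr => i _; rewrite nth_mkseq // coef_map.
  by apply: leq_trans (ltnW qp); apply: size_poly.
exists s; split=> //; split; first by apply/sE; exists 1; rewrite rmorph1.
move=> x y /(mem_lspan k)/sE[r ->] /(mem_lspan k)/sE[r' ->]; apply/sE.
by exists (r * r'); rewrite rmorphM.
Qed.

Lemma subalg_gen_image (C T B : comPzRingType) (k : {rmorphism C -> T})
    (f : {rmorphism T -> B}) (l : {rmorphism C -> B}) :
  finite_map k -> (forall c, f (k c) = l c) ->
  exists s, subalg_gen l s /\ forall x, lspan l s x <-> exists t, x = f t.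
Proof.
move=> [s sgen] fk.
have sE x : lspan l (map f s) x <-> exists t, x = f t.
  split.
    move: x; apply: lspan_ind => [|_ _ [r ->] [r' ->]|a _ /mapP[t _ ->]].
    - by exists 0; rewrite rmorph0.
    - by exists (r + r'); rewrite rmorphD.
    - by exists (k a * t); rewrite rmorphM fk.
  move=> [t ->]; have [c ->] := sgen t; exists c.
  rewrite size_map rmorph_sum; apply: eq_bigr => i _.
  by rewrite rmorphM fk (nth_map 0).
exists (map f s); split=> //; split; first by apply/sE; exists 1; rewrite rmorph1.
move=> x y /(mem_lspan l)/sE[r ->] /(mem_lspan l)/sE[r' ->]; apply/sE.
by exists (r * r'); rewrite rmorphM.
Qed.

Lemma subalg_gen_join (C B : comPzRingType) (k : {rmorphism C -> B}) (s1 s2 : seq B) :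
  subalg_gen k s1 -> subalg_gen k s2 ->
  exists s, [/\ subalg_gen k s, forall x, lspan k s1 x -> lspan k s x
    & forall x, lspan k s2 x -> lspan k s x].
Proof.
move=> sg1 sg2; have [s11 sM1] := sg1; have [s21 sM2] := sg2.
pose s := [seq x * y | x <- s1, y <- s2].
have sP x y : lspan k s1 x -> lspan k s2 y -> lspan k s (x * y).
  move=> + sy; move: x; apply: lspan_ind => [|x x' ? ?|a x xs].
  - by rewrite mul0r; apply: lspan0.
  - by rewrite mulrDl; apply: lspanD.
  rewrite -mulrA; apply: lspanZ; move: y sy; apply: lspan_ind => [|y y' ? ?|b y ys].
  - by rewrite mulr0; apply: lspan0.
  - by rewrite mulrDr; apply: lspanD.
  by rewrite mulrCA; apply: lspanZ; apply: mem_lspan; apply: allpairs_f.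
exists s; split.
- split; first by rewrite -[1]mulr1; apply: sP.
  move=> _ _ /allpairsP[[x y] /= [xs ys ->]] /allpairsP[[x' y'] /= [xs' ys' ->]].
  by rewrite mulrACA; apply: sP; [apply: sM1|apply: sM2].
- by move=> x sx; rewrite -[x]mulr1; apply: sP.
- by move=> x sx; rewrite -[x]mul1r; apply: sP.
Qed.

Lemma subalg_gen_bigjoin (C B : comPzRingType) (k : {rmorphism C -> B}) (J : eqType)
    (r : seq J) (U : J -> B -> Prop) :
  (forall j, j \in r -> exists s, subalg_gen k s /\ forall x, U j x -> lspan k s x) ->
  exists s, subalg_gen k s /\ forall j x, j \in r -> U j x -> lspan k s x.
Proof.
elim: r => [|j r IH] Ur.
  exists [:: 1]; split=> //; split; first by apply: mem_lspan; rewrite mem_head.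
  move=> x y; rewrite !inE => /eqP -> /eqP ->; rewrite mulr1.
  by apply: mem_lspan; rewrite mem_head.
have [|s2 [sg2 U2]] := IH.
  by move=> i ir; apply: Ur; rewrite in_cons ir orbT.
have [s1 [sg1 U1]] := Ur j (mem_head _ _).
have [s [sg s1s s2s]] := subalg_gen_join sg1 sg2.
exists s; split=> // i x; rewrite in_cons => /orP[/eqP -> /U1/s1s//|ir Uix].
by apply: s2s; apply: U2 Uix.
Qed.

Lemma finite_map_comp (A B D : comPzRingType) (f : {rmorphism A -> B})
    (g : {rmorphism B -> D}) : finite_map f -> finite_map g -> finite_map (g \o f).
Proof.
move=> [s sgen] [t tgen]; exists [seq g x * y | x <- s, y <- t] => d.
suff : lspan (g \o f) [seq g x * y | x <- s, y <- t] d by [].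
have [b ->] := tgen d; apply: lspan_sum => i.
have [a ->] := sgen b`_i; rewrite rmorph_sum mulr_suml; apply: lspan_sum => j.
rewrite rmorphM -mulrA; apply: (lspanZ (k := g \o f)); apply: mem_lspan.
by apply: allpairs_f; apply: mem_nth.
Qed.

Lemma finite_map_quotient (A B D : comPzRingType) (f : {rmorphism A -> B})
    (g : {rmorphism B -> D}) :
  finite_map f -> (forall d, exists b, g b = d) -> finite_map (g \o f).
Proof.
move=> ff gsurj; apply: finite_map_comp => //; exists [:: 1] => y.
have [b <-] := gsurj y; exists [:: b].
by rewrite big_ord_recl big_ord0 /= addr0 mulr1.
Qed.

(* The ring [C] is only required to be a splinter near the contraction along [pi]
   of the maximal ideal of the local ring [L]. *)
Definition splinter_at (C L : comNzRingType) (pi : {rmorphism C -> L}) : Prop :=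
  forall (T : comPzRingType) (k : {rmorphism C -> T}),
    finite_map k -> spec_surjective k ->
    exists F : T -> C, [/\ forall y z, F (y + z) = F y + F z,
      forall r y, F (k r * y) = r * F y & is_unit (pi (F 1))].

(** The subalgebra is finite over [C] and contains it, so lying over makes it a cover. [F] is total
    on [B], and linear only on the span, to keep the type of the subring out of later arguments. *)
Lemma splinter_at_subalg (C L B : comNzRingType) (pi : {rmorphism C -> L})
    (k : {rmorphism C -> B}) (s : seq B) :
  splinter_at pi -> injective k -> subalg_gen k s ->
  exists F : B -> C,
    [/\ forall y z, lspan k s y -> lspan k s z -> F (y + z) = F y + F z,
        forall r y, lspan k s y -> F (k r * y) = r * F y & is_unit (pi (F 1))].
Proof.
move=> spl kinj sg; have [Z [v [kZ [vinj vk kfin vE]]]] := subalg_type sg.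
have kZinj : injective kZ by move=> x y /(congr1 v); rewrite !vk => /kinj.
have [F [FD FZ F1]] := spl Z kZ kfin (lying_over kfin kZinj).
have /choice[w wE] (b : B) : exists z, lspan k s b -> v z = b.
  have [/vE[z <-]|] := pselect (lspan k s b); first by exists z.
  by exists 0.
have wv z : w (v z) = z by apply: vinj; rewrite wE //; apply/vE; exists z.
exists (F \o w); split=> [y z /vE[y' <-] /vE[z' <-]|r y /vE[y' <-]|] /=.
- by rewrite -rmorphD !wv FD.
- by rewrite -vk -rmorphM !wv FZ.
- by rewrite -(rmorph1 v) wv.
Qed.

Lemma prime_image (A D : comPzRingType) (q : {rmorphism A -> D}) (p : A -> Prop) :
  (forall d, exists a, q a = d) -> is_prime_ideal p -> (forall a, q a = 0 -> p a) ->
  exists Q, is_prime_ideal Q /\ forall a, p a <-> Q (q a).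
Proof.
move=> qsurj [[p0 pD pMl] p1 pM] qker.
have pq a b : q a = q b -> p b -> p a.
  move=> /eqP; rewrite -subr_eq0 -rmorphB => /eqP/qker pab pb.
  by rewrite -(subrK b a); apply: pD.
exists (fun d => exists2 a, q a = d & p a); split; last first.
  by move=> a; split=> [pa|[b bE pb]]; [exists a|apply: pq pb].
split; first split.
- by exists 0; rewrite ?rmorph0.
- by move=> _ _ [a <- pa] [b <- pb]; exists (a + b); rewrite ?rmorphD //; apply: pD.
- move=> r _ [a <- pa]; have [c <-] := qsurj r.
  by exists (c * a); rewrite ?rmorphM //; apply: pMl.
- by move=> [a aE pa]; apply: p1; apply: pq pa; rewrite rmorph1 aE.
- move=> d e [a aE pa]; have [c cE] := qsurj d; have [b bE] := qsurj e.
  have /pM[pc|pb] : p (c * b) by apply: pq pa; rewrite rmorphM cE bE aE.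
    by left; exists c.
  by right; exists b.
Qed.

Lemma prime_preimage (A D : comPzRingType) (f : {rmorphism A -> D}) (Q : D -> Prop) :
  is_prime_ideal Q -> is_prime_ideal (fun a => Q (f a)).
Proof.
move=> [[Q0 QD QM] Q1 QP]; split; first split.
- by rewrite rmorph0.
- by move=> x y; rewrite rmorphD; apply: QD.
- by move=> r x; rewrite rmorphM; apply: QM.
- by rewrite rmorph1.
- by move=> a b; rewrite rmorphM; apply: QP.
Qed.

(** If [x y = 0], every prime contains [x] or [y], so the product of [C / x] and [C / y] is a finite
    cover. As [F 1] is the sum of the values at the two idempotents, one of these values is a unit
    in [L]; it is killed by [x] or by [y] respectively, which must then be 0. *)
Lemma splinter_at_domain (C L : comNzRingType) (pi : {rmorphism C -> L}) :
  units_local L -> injective pi -> splinter_at pi -> is_domain C.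
Proof.
move=> [_ lL] piinj spl x y xy0.
have Ip (a : C) : is_ideal (fun c => exists r, c = r * a).
  split=> [|_ _ [r ->] [r' ->]|u _ [r ->]]; first by exists 0; rewrite mul0r.
    by exists (r + r'); rewrite mulrDl.
  by exists (u * r); rewrite mulrA.
have [D1 [q1 [q1surj q1ker]]] := quotient_pz (Ip x).
have [D2 [q2 [q2surj q2ker]]] := quotient_pz (Ip y).
pose T : comPzRingType := (D1 * D2)%type.
have [k kE] : exists k : {rmorphism C -> T}, forall c, k c = (q1 c, q2 c).
  by apply: rmorphism_of_fun => [a b|a b|] /=; rewrite ?rmorphD ?rmorphM ?rmorph1.
have kx : k x * (1, 0) = 0.
  have q1x : q1 x = 0 by apply/q1ker; exists 1; rewrite mul1r.
  by rewrite kE q1x; congr pair; rewrite ?mul0r ?mulr0.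
have ky : k y * (0, 1) = 0.
  have q2y : q2 y = 0 by apply/q2ker; exists 1; rewrite mul1r.
  by rewrite kE q2y; congr pair; rewrite ?mul0r ?mulr0.
have kfin : finite_map k.
  exists [:: (1, 0); (0, 1)] => -[t1 t2].
  have [a <-] := q1surj t1; have [b <-] := q2surj t2; exists [:: a; b].
  rewrite !big_ord_recl big_ord0 /= addr0 !kE; congr pair;
    by rewrite /= ?mulr1 ?mulr0 ?addr0 ?add0r.
have ksp : spec_surjective k.
  move=> p pp; have [Ipp p1 pM] := pp; have [_ _ pMl] := Ipp.
  have [px|py] : p x \/ p y by apply: pM; rewrite xy0; case: Ipp.
  - have [|Q [pQ QE]] := prime_image q1surj pp.
      by move=> c /q1ker[r ->]; apply: pMl.
    exists (fun t : T => Q t.1); split; first exact: (prime_preimage fst).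
    by move=> c; rewrite kE.
  - have [|Q [pQ QE]] := prime_image q2surj pp.
      by move=> c /q2ker[r ->]; apply: pMl.
    exists (fun t : T => Q t.2); split; first exact: (prime_preimage snd).
    by move=> c; rewrite kE.
have [F [FD FZ]] := spl T k kfin ksp.
have F0 : F 0 = 0 by apply: (addrI (F 0)); rewrite -FD !addr0.
have -> : (1 : T) = (1, 0) + (0, 1) by congr pair; rewrite ?addr0 ?add0r.
have unit0 a b : is_unit (pi b) -> a * b = 0 -> a = 0.
  move=> ub ab; apply: piinj; rewrite rmorph0; apply: (unit_mul_eq0 ub).
  by rewrite -rmorphM mulrC ab rmorph0.
rewrite FD rmorphD => /lL[u1|u2]; [left|right].
  by apply: unit0 u1 _; rewrite -FZ kx F0.
by apply: unit0 u2 _; rewrite -FZ ky F0.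
Qed.

(** * Krull's intersection theorem and Henselian quotients *)

Definition is_submod (R : comNzRingType) n (U : 'rV[R]_n -> Prop) : Prop :=
  [/\ U 0, forall v w, U v -> U w -> U (v + w) & forall a v, U v -> U (a *: v)].

Lemma submodB (R : comNzRingType) n (U : 'rV[R]_n -> Prop) v w :
  is_submod U -> U v -> U w -> U (v - w).
Proof. by move=> [_ UD UZ] Uv Uw; apply: UD => //; rewrite -scaleN1r; apply: UZ. Qed.

Lemma submod_sum (R : comNzRingType) n (U : 'rV[R]_n -> Prop) (J : Type) (r : seq J)
    (F : J -> 'rV[R]_n) :
  is_submod U -> (forall j, U (F j)) -> U (\sum_(j <- r) F j).
Proof. by move=> [U0 UD _] UF; elim/big_ind: _. Qed.

Lemma kernel_submod (R : comNzRingType) (S : comPzRingType) (kap : {rmorphism R -> S}) n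
    (t : 'I_n -> S) :
  is_submod (fun lam : 'rV[R]_n => \sum_i kap (lam 0 i) * t i = 0).
Proof.
split=> [|v w v0 w0|a v v0].
- by rewrite big1 // => i _; rewrite mxE rmorph0 mul0r.
- under eq_bigr do rewrite mxE rmorphD mulrDl.
  by rewrite big_split /= v0 w0 addr0.
- under eq_bigr do rewrite mxE rmorphM -mulrA.
  by rewrite -mulr_sumr v0 mulr0.
Qed.

Definition row_cons0 (R : comNzRingType) n (w : 'rV[R]_n) : 'rV[R]_n.+1 :=
  row_mx (0 : 'rV_1) w.

Lemma row_cons0E (R : comNzRingType) n (v : 'rV[R]_n.+1) : v 0 ord0 = 0 ->
  v = row_cons0 (rsubmx (v : 'rV_(1 + n))).
Proof.
move=> v0; apply/rowP => i; rewrite !mxE; case: (@splitP 1 n i) => l il; rewrite !mxE.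
  by rewrite -v0; congr (v _ _); apply: val_inj; rewrite /= il ord1.
by congr (v _ _); apply: val_inj.
Qed.

Lemma row_cons0Z (R : comNzRingType) n a (v : 'rV[R]_n) :
  row_cons0 (a *: v) = a *: row_cons0 v.
Proof. by apply/rowP => i; rewrite !mxE; case: split => k; rewrite !mxE ?mulr0. Qed.

Lemma submod_row_cons0 (R : comNzRingType) n (W : 'rV[R]_n.+1 -> Prop) :
  is_submod W -> is_submod (fun w => W (row_cons0 w)).
Proof.
have cons0D (v w : 'rV[R]_n) : row_cons0 (v + w) = row_cons0 v + row_cons0 w.
  by apply/rowP => i; rewrite !mxE; case: split => k; rewrite !mxE ?addr0.
have cons00 : row_cons0 (0 : 'rV[R]_n) = 0.
  by apply/rowP => i; rewrite !mxE; case: split => k; rewrite !mxE.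
move=> [W0 WD WZ]; split=> [|v w|a v]; rewrite ?cons0D ?row_cons0Z ?cons00 //.
  exact: WD.
exact: WZ.
Qed.

(** The first coordinates of [U] form a finitely generated ideal; lifts of its generators, with
    generators of the part of [U] having first coordinate 0, generate [U]. Generation is tested
    against all submodules [V], which is the form needed for arguments by linearity. *)
Lemma submod_finitely_generated (R : comNzRingType) : noetherian R ->
  forall n (U : 'rV[R]_n -> Prop), is_submod U ->
  exists s : seq 'rV[R]_n, (forall v, v \in s -> U v) /\
    forall V : 'rV[R]_n -> Prop, is_submod V -> (forall v, v \in s -> V v) ->
      forall v, U v -> V v.
Proof.
move=> noeth; elim=> [|n IH] U sU; have [U0 UD UZ] := sU.
  by exists [::]; split=> // V [V0 _ _] _ v _; rewrite thinmx0.
have [s' [s'U s'gen]] := IH _ (submod_row_cons0 sU).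
have [|s sE] := noeth (fun a => exists2 v, U v & v 0 ord0 = a).
  split=> [|_ _ [v Uv <-] [w Uw <-]|a _ [v Uv <-]]; first by exists 0; rewrite ?mxE.
    by exists (v + w); rewrite ?mxE //; apply: UD.
  by exists (a *: v); rewrite ?mxE //; apply: UZ.
have /choice[f fE] (i : 'I_(size s)) : exists v, U v /\ v 0 ord0 = s`_i.
  have [_] := sE s`_i; case=> [|v Uv vE]; last by exists v.
  have si := ltn_ord i; exists (mkseq (fun j => (j == i)%:R) (size s)).
  rewrite (bigD1 i) //= nth_mkseq // eqxx mul1r big1 ?addr0 // => j ji.
  by rewrite nth_mkseq // val_eqE (negbTE ji) mul0r.
exists ([seq f i | i <- enum 'I_(size s)] ++ map (@row_cons0 R n) s'); split=> [v|V sV Vs v Uv].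
  rewrite mem_cat => /orP[/mapP[i _ ->]|/mapP[w ws ->]]; first by case: (fE i).
  exact: s'U.
have [V0 VD VZ] := sV.
have Vf i : V (f i).
  by apply: Vs; rewrite mem_cat; apply/orP; left; apply: map_f; rewrite mem_enum.
have [c cE] : exists c : seq R, v 0 ord0 = \sum_(i < size s) c`_i * s`_i.
  by apply/sE; exists v.
pose u := \sum_(i < size s) c`_i *: f i.
have Vu : V u by apply: submod_sum => // i; apply: VZ.
have Uvu : U (v - u).
  apply: submodB => //; apply: submod_sum => // i; apply: UZ; by case: (fE i).
have vuE : v - u = row_cons0 (rsubmx (v - u : 'rV_(1 + n))).
  apply: row_cons0E.
  rewrite !mxE cE /u summxE -sumrB big1 // => l _.
  by rewrite !mxE (fE l).2 subrr.
rewrite -(subrK u v); apply: (VD) => //; rewrite vuE.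
apply: (s'gen _ (submod_row_cons0 sV)) => [w ws|]; last by rewrite -vuE.
by apply: Vs; rewrite mem_cat map_f ?orbT.
Qed.

Definition primary_to_nonunits (R : comPzRingType) (J : R -> Prop) : Prop :=
  [/\ is_ideal J, ~ J 1 & forall x, ~ is_unit x -> exists k, J (x ^+ k)].

(* If [v] is not in [U], take a submodule [L] maximal among those containing [U + m v]
   but not [v]. Since [R] is Noetherian, [J := (L : R^n)] is [m]-primary, so the
   hypothesis yields [v] in [U + J R^n], which is contained in [L]. *)
Lemma krull_intersection (R : comNzRingType) n (U : 'rV[R]_n -> Prop) (v : 'rV[R]_n) :
  noetherian R -> units_local R -> is_submod U ->
  (forall J, primary_to_nonunits J -> exists u, U u /\ forall i, J ((v - u) 0 i)) ->
  U v.
Proof.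
move=> noeth lR sU Uv; apply: contrapT => nUv; have [nu0 lRD] := lR.
have [U0 UD UZ] := sU.
pose U1 w := exists u a, [/\ U u, ~ is_unit a & w = u + a *: v].
have sU1 : is_submod U1.
  split.
  - by exists 0, 0; rewrite scale0r addr0.
  - move=> _ _ [u [a [Uu nua ->]]] [u' [a' [Uu' nua' ->]]].
    exists (u + u'), (a + a'); split; [exact: UD|by case/lRD|].
    by rewrite scalerDl addrACA.
  - move=> b _ [u [a [Uu nua ->]]]; exists (b *: u), (b * a); split; first exact: UZ.
      by move=> /unit_mulr.
    by rewrite scalerDr scalerA.
(* Nakayama for a single vector: [v = u + a v] gives [(1 - a) v = u], and [1 - a] is a unit. *)
have nU1v : ~ U1 v.
  move=> [u [a [Uu nua vE]]].
  have [b] : is_unit (1 - a) by apply: local_add_unit (unit1 R) _ => // /unit_opp; rewrite opprK.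
  have uE : u = (1 - a) *: v by rewrite scalerBl scale1r {1}vE addrK.
  rewrite mulrC => ba; apply: nUv; rewrite -[v]scale1r -ba -scalerA -uE.
  exact: UZ.
pose P L := is_submod L /\ ~ L v.
have [|F [X0 FX0] FP Ftot|L [[sL nLv] U1L Lmax]] := @exists_maximal_pred 'rV[R]_n P U1.
- by [].
- have Fs X : F X -> is_submod X by move=> /FP[].
  split; last by move=> [X [FX Xv]]; apply: (FP _ FX).2.
  split.
  + by exists X0; split=> //; have [] := Fs _ FX0.
  + move=> x y [X [FX Xx]] [Y [FY Yy]].
    have [XY|YX] := Ftot _ _ FX FY.
      by exists Y; split=> //; have [_ YD _] := Fs _ FY; apply: YD => //; apply: XY.
    by exists X; split=> //; have [_ XD _] := Fs _ FX; apply: XD => //; apply: YX.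
  + by move=> r x [X [FX Xx]]; exists X; split=> //; have [_ _ XM] := Fs _ FX; apply: XM.
have [L0 LD LZ] := sL.
pose J r := forall w, L (r *: w).
have prJ : primary_to_nonunits J.
  split.
  - split=> [w|x y Jx Jy w|r x Jx w]; first by rewrite scale0r.
      by rewrite scalerDl; apply: LD.
    by rewrite -scalerA; apply: LZ.
  - by move=> /(_ v); rewrite scale1r.
  (* By finite generation of [W], one exponent [N] serves all vectors moved into [L] by a power of
     [x]. If [x ^ N w0] were outside [L], maximality would give [v = l + x ^ N w] with [l] in [L].
     Since [x v] is in [L], so is [x ^ (N + 1) w], hence [x ^ N w], hence [v]: a contradiction. *)
  move=> x nux; pose W w := exists j, L (x ^+ j *: w).
  have Lx j k w : (j <= k)%N -> L (x ^+ j *: w) -> L (x ^+ k *: w).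
    by move=> /subnK <- Ljw; rewrite exprD -scalerA; apply: LZ.
  have sW : is_submod W.
    split; first by exists 0; rewrite scaler0.
      move=> w w' [j Lj] [k Lk]; exists (maxn j k); rewrite scalerDr; apply: LD.
        exact: Lx (leq_maxl _ _) Lj.
      exact: Lx (leq_maxr _ _) Lk.
    by move=> a w [j Lj]; exists j; rewrite scalerA mulrC -scalerA; apply: LZ.
  have [s [sW' sgen]] := submod_finitely_generated noeth sW.
  have [N NE] : exists N, forall w, w \in s -> L (x ^+ N *: w).
    elim: s sW' {sgen} => [|w s IH] sW'; first by exists 0.
    have [|N NE] := IH; first by move=> y ys; apply: sW'; rewrite in_cons ys orbT.
    have [j Lj] := sW' w (mem_head _ _); exists (maxn j N) => y.
    rewrite in_cons => /orP[/eqP ->|/NE]; first exact: Lx (leq_maxl _ _) Lj.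
    exact: Lx (leq_maxr _ _).
  have WN w : W w -> L (x ^+ N *: w).
    apply: (sgen (fun w => L (x ^+ N *: w))) => //.
    split=> [|y z Ly Lz|a y Ly]; first by rewrite scaler0.
      by rewrite scalerDr; apply: LD.
    by rewrite scalerA mulrC -scalerA; apply: LZ.
  exists N => w0; apply: contrapT => nLw0.
  pose L2 y := exists l w, L l /\ y = l + x ^+ N *: w.
  have sL2 : is_submod L2.
    split; first by exists 0, 0; rewrite scaler0 addr0.
      move=> _ _ [l [w [Ll ->]]] [l' [w' [Ll' ->]]]; exists (l + l'), (w + w').
      by rewrite scalerDr addrACA; split=> //; apply: LD.
    move=> a _ [l [w [Ll ->]]]; exists (a *: l), (a *: w).
    by rewrite scalerDr !scalerA mulrC; split=> //; apply: LZ.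
  have LL2 y : L y -> L2 y by exists y, 0; rewrite scaler0 addr0.
  have [l [w [Ll vE]]] : L2 v.
    apply: contrapT => nL2v; apply: nLw0; apply: (Lmax L2) => //.
    by exists 0, w0; rewrite add0r.
  apply: nLv; rewrite vE; apply: LD => //; apply: WN; exists N.+1.
  have -> : x ^+ N.+1 *: w = x *: v - x *: l.
    by rewrite vE scalerDr addrC addKr exprS scalerA.
  apply: submodB => //; last exact: LZ.
  by apply: U1L; exists 0, x; rewrite add0r.
have [u [Uu Ju]] := Uv J prJ; apply: nLv.
rewrite -(subrK u v); apply: LD; last by apply: U1L; exists u, 0; rewrite scale0r addr0.
rewrite [v - u]row_sum_delta; apply: submod_sum => // i.
exact: Ju.
Qed.

Lemma horner_taylor2 (A : comNzRingType) (f : {poly A}) (a h : A) :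
  exists w, f.[a + h] = f.[a] + f^`().[a] * h + h ^+ 2 * w.
Proof.
elim/poly_ind: f => [|f c [w IH]].
  by exists 0; rewrite deriv0 !horner0 mul0r mulr0 !addr0.
exists (w * (a + h) + f^`().[a]).
rewrite derivMXaddC !hornerMXaddC hornerD hornerMX IH; ring.
Qed.

(** Newton iteration: with [b] the inverse of the derivative at [a0], the value of [f] at
    [a0 - b f(a0)] is divisible by the square of [f(a0)]. *)
Lemma nil_henselian (A : comNzRingType) : units_local A ->
  (forall x : A, ~ is_unit x -> exists k, x ^+ k = 0) -> henselian A.
Proof.
move=> lA nilA; split; first exact/is_localP.
move=> f _ a0 nfa0 ufa0; have [k] := nilA _ nfa0.
have [n] := ubnP k; elim: n k a0 nfa0 ufa0 => // n IH k a0 nfa0 [b fb] kn fk.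
have [k1|k1] := leqP k 1.
  exists a0; split; last by rewrite subrr; case: lA.
  by rewrite -[f.[a0]]expr1 -(subnKC k1) exprD fk mul0r.
pose a1 := a0 + - (b * f.[a0]).
have [w fa1] := horner_taylor2 f a0 (- (b * f.[a0])).
have {}fa1 : f.[a1] = f.[a0] ^+ 2 * (b ^+ 2 * w).
  have -> : f.[a1] = f.[a0] * (1 - f^`().[a0] * b) + f.[a0] ^+ 2 * (b ^+ 2 * w).
    by rewrite fa1; ring.
  by rewrite fb subrr mulr0 add0r.
have na1 : ~ is_unit (a1 - a0).
  by rewrite /a1 addrC addKr => /unit_opp; rewrite opprK => /unit_mulr.
(* The exponent drops by one at least: the square of [f(a0)] raised to [k - 1] is 0, as [2 (k - 1)]
   is at least [k] for [k > 1]. *)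
have [||||a [fa na]] := IH (k - 1)%N a1.
- by rewrite fa1 expr2 -mulrA => /unit_mull.
- by apply: (local_sub_unit lA) (local_horner_sub na1) _; exists b.
- by rewrite subn1 prednK ?(ltnW k1).
- rewrite fa1 exprMn -exprM.
  have -> : (2 * (k - 1) = k + (k - 2))%N.
    by case: k k1 {IH kn fk} => [|[|k]] // _; rewrite !subSS !subn0 mul2n -addnn addnS !addSn.
  by rewrite exprD fk !mul0r.
exists a; split=> //; rewrite -(subrK a1 a) -addrA => /lA.2[].
  exact: na.
exact: na1.
Qed.

(** Every nonunit of [R] has a power in [J], so the nonunits of the quotient are nilpotent and
    [nil_henselian] applies. *)
Lemma primary_quotient_henselian (R D : comNzRingType) (q : {rmorphism R -> D})
    (J : R -> Prop) :
  units_local R -> primary_to_nonunits J -> (forall d, exists a, q a = d) ->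
  (forall x, q x = 0 <-> J x) -> henselian D /\ local_hom q.
Proof.
move=> lR [IJ J1 Jpow] qsurj qker.
have qloc : local_hom q.
  move=> x [d]; have [y <-] := qsurj d => qxy; apply: contrapT => /Jpow[k Jk].
  apply: J1; apply/qker; rewrite rmorph1 -(expr1n D k) -qxy exprMn -rmorphXn.
  by move/qker: Jk => ->; rewrite mul0r.
have D1 : (1 : D) <> 0 by rewrite -(rmorph1 q) => /qker.
split=> //; apply: nil_henselian; last first.
  move=> d; have [a <-] := qsurj d => nqa.
  have [|k /qker Jk] := Jpow a; first by move=> /(unit_rmorph q).
  by exists k; rewrite -rmorphXn.
split=> [[d]|d e]; first by rewrite mul0r => e; apply: D1.
have [a <-] := qsurj d; have [b <-] := qsurj e; rewrite -rmorphD => /qloc/lR.2[] u.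
  by left; apply: unit_rmorph.
by right; apply: unit_rmorph.
Qed.

Lemma henselization_quotient (R Rh : comNzRingType) (phi : {rmorphism R -> Rh})
    (J : R -> Prop) :
  units_local R -> is_henselization phi -> primary_to_nonunits J ->
  exists (D : comNzRingType) (q : {rmorphism R -> D}) (theta : {rmorphism Rh -> D}),
    [/\ forall d, exists a, q a = d, forall x, q x = 0 <-> J x
      & forall x, theta (phi x) = q x].
Proof.
move=> lR [_ _ univ] prJ; have [IJ J1 _] := prJ.
have [D [q [qsurj qker]]] := quotient_nz IJ J1.
have [hD qloc] := primary_quotient_henselian lR prJ qsurj qker.
have [[theta [_ thetaE]] _] := univ D q hD qloc.
by exists D, q, theta.
Qed.

(** An element killed by [phi] vanishes in every [R / J], since these quotients factor through
    [phi]; Krull's theorem for the zero submodule of [R] concludes. *)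
Lemma henselization_inj (R Rh : comNzRingType) (phi : {rmorphism R -> Rh}) :
  noetherian R -> units_local R -> is_henselization phi -> injective phi.
Proof.
move=> noeth lR hphi; apply: rmorph_injP => x phix.
pose U (v : 'rV[R]_1) := v = 0.
have sU : is_submod U.
  by split=> // [v w -> ->|a v ->]; rewrite /U ?addr0 ?scaler0.
have /matrixP/(_ 0 0) : U (const_mx x).
  apply: krull_intersection => // J prJ.
  have [D [q [theta [_ qker thetaE]]]] := henselization_quotient lR hphi prJ.
  exists 0; split=> // i; rewrite !mxE subr0; apply/qker.
  by rewrite -thetaE phix rmorph0.
by rewrite !mxE.
Qed.

(** * Descent from the Henselization *)

Lemma additive_sum (A B : nmodType) (P : A -> Prop) (f : A -> B) (J : Type)
    (r : seq J) (F : J -> A) :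
  P 0 -> (forall x y, P x -> P y -> P (x + y)) -> f 0 = 0 ->
  (forall x y, P x -> P y -> f (x + y) = f x + f y) -> (forall j, P (F j)) ->
  f (\sum_(j <- r) F j) = \sum_(j <- r) f (F j).
Proof.
move=> P0 PD f0 fD PF; elim: r => [|j r IH]; first by rewrite !big_nil.
rewrite !big_cons fD ?IH //; elim/big_ind: _ => //.
Qed.

Lemma lspan_row (C B : comPzRingType) (k : {rmorphism C -> B}) (s : seq B) y :
  lspan k s y -> exists c : 'rV[C]_(size s), y = \sum_i k (c 0 i) * s`_i.
Proof.
by move=> [c ->]; exists (\row_i c`_i); apply: eq_bigr => i _; rewrite mxE.
Qed.

(** [y] prescribes the values on the generators [s]. Killing all relations makes the prescription
    well defined, and the condition on [u] says that 1 is sent to 1. *)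
Lemma linear_map_of_solution (R : comNzRingType) (S : comPzRingType)
    (kap : {rmorphism R -> S}) (s : seq S) (u y : 'rV[R]_(size s)) :
  (forall t, lspan kap s t) ->
  (forall lam : 'rV_(size s), \sum_i kap (lam 0 i) * s`_i = 0 ->
     \sum_i lam 0 i * y 0 i = 0) ->
  1 = \sum_i kap (u 0 i) * s`_i -> \sum_i u 0 i * y 0 i = 1 ->
  has_module_retraction kap.
Proof.
move=> sgen rel uE uy.
have /choice[c cE] (t : S) : exists c : 'rV[R]_(size s), t = \sum_i kap (c 0 i) * s`_i
  by apply: lspan_row.
pose val (lam : 'rV[R]_(size s)) := \sum_i kap (lam 0 i) * s`_i.
pose dot (lam : 'rV[R]_(size s)) := \sum_i lam 0 i * y 0 i.
have dotB lam mu : dot (lam - mu) = dot lam - dot mu.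
  by rewrite /dot -sumrB; apply: eq_bigr => i _; rewrite !mxE mulrBl.
have valB lam mu : val (lam - mu) = val lam - val mu.
  by rewrite /val -sumrB; apply: eq_bigr => i _; rewrite !mxE rmorphB mulrBl.
have dotE lam t : val lam = t -> dot (c t) = dot lam.
  move=> lamE; apply/eqP; rewrite -subr_eq0 -dotB; apply/eqP/rel.
  by rewrite -/(val (c t - lam)) valB lamE /val -cE subrr.
have g1 : dot (c 1) = 1 by rewrite (dotE u).
have gZ r t : dot (c (kap r * t)) = r * dot (c t).
  rewrite (dotE (r *: c t)).
    by rewrite /dot mulr_sumr; apply: eq_bigr => i _; rewrite mxE mulrA.
  rewrite [in RHS](cE t) /val mulr_sumr; apply: eq_bigr => i _.
  by rewrite mxE rmorphM mulrA.
exists (fun t => dot (c t)); split=> // [t t'|r].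
  rewrite (dotE (c t + c t')).
    by rewrite /dot -big_split; apply: eq_bigr => i _; rewrite mxE mulrDl.
  rewrite [in RHS](cE t) [in RHS](cE t') /val -big_split; apply: eq_bigr => i _.
  by rewrite mxE rmorphD mulrDl.
by rewrite -[kap r]mulr1 gZ g1 mulr1.
Qed.

(** The values of [g] on generators of [S] solve over [Rh] a linear system with coefficients in [R].
    Mapped to each [R / J] and lifted, they put the right-hand side in the column span modulo [J],
    and Krull's theorem removes [J]. *)
Lemma retraction_descends (R Rh : comNzRingType) (phi : {rmorphism R -> Rh})
    (S : comPzRingType) (kap : {rmorphism R -> S}) (g : S -> Rh) :
  noetherian R -> units_local R -> is_henselization phi -> finite_map kap ->
  (forall x y, g (x + y) = g x + g y) -> (forall r x, g (kap r * x) = phi r * g x) ->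
  g 1 = 1 -> has_module_retraction kap.
Proof.
move=> noeth lR hphi [s sgen] gD gZ g1.
have g0 : g 0 = 0 by apply: (addrI (g 0)); rewrite -gD !addr0.
have gsum (lam : 'rV[R]_(size s)) :
    g (\sum_i kap (lam 0 i) * s`_i) = \sum_i phi (lam 0 i) * g s`_i.
  rewrite (big_morph g gD g0).
  by apply: eq_bigr => i _; rewrite gZ.
have [u uE] := lspan_row (sgen 1).
pose rel (lam : 'rV[R]_(size s)) := \sum_i kap (lam 0 i) * s`_i = 0.
have srel : is_submod rel by apply: kernel_submod.
have [rho [rhorel rhogen]] := submod_finitely_generated noeth srel.
pose n := size rho.
(* Row 0 holds the coordinates of 1 and the other rows generate the relations, so a retraction
   amounts to a [y] whose product with row 0 is 1 and with the others 0. *)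
pose M := \matrix_(i < n.+1, j < size s) (nth 0 (u :: rho) i) 0 j.
pose U (w : 'rV[R]_n.+1) := exists y, w = y *m M^T.
have sU : is_submod U.
  split; first by exists 0; rewrite mul0mx.
    by move=> _ _ [y ->] [y' ->]; exists (y + y'); rewrite mulmxDl.
  by move=> a _ [y ->]; exists (a *: y); rewrite scalemxAl.
have [y yE] : U (delta_mx 0 0).
  apply: krull_intersection => // J prJ.
  have [D [q [theta [qsurj qker thetaE]]]] := henselization_quotient lR hphi prJ.
  have /choice[f fE] (j : 'I_(size s)) := qsurj (theta (g s`_j)).
  exists ((\row_j f j) *m M^T); split=> [|i]; first by exists (\row_j f j).
  apply/qker; rewrite !mxE rmorphB rmorph_sum.
  have -> : \sum_j q ((\row_j f j) 0 j * M^T j i) =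
      theta (g (\sum_j kap ((nth 0 (u :: rho) i) 0 j) * s`_j)).
    rewrite gsum rmorph_sum; apply: eq_bigr => j _.
    by rewrite !mxE !rmorphM fE thetaE mulrC.
  rewrite eqxx /=; case: i => -[|i] hi.
    by rewrite /= -uE g1 !rmorph1 subrr.
  rewrite [\sum_j _]rhorel; last by apply: mem_nth.
  by rewrite g0 !rmorph0 subrr.
have yM i : \sum_j (nth 0 (u :: rho) (i : 'I_n.+1)) 0 j * y 0 j = (i == 0)%:R.
  have /rowP/(_ i) := yE; rewrite !mxE eqxx /= => ->; apply: eq_bigr => j _.
  by rewrite !mxE mulrC.
apply: (linear_map_of_solution (u := u) (y := y)) => //; last first.
  by have := yM 0.
apply: rhogen => [|v]; first exact: (kernel_submod (idfun : {rmorphism R -> R})).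
move=> vrho; have vi : (index v rho < n)%N by rewrite index_mem.
by have := yM (lift ord0 (Ordinal vi)); rewrite /= nth_index.
Qed.

Lemma splinter_splinter_at (R : comNzRingType) :
  splinter R -> splinter_at (idfun : {rmorphism R -> R}).
Proof.
move=> spl T k kfin ksp; have [g [gD gZ g1]] := spl T k kfin ksp.
by exists g; split=> //=; rewrite -(rmorph1 k) g1; apply: unit1.
Qed.

(** The [Rh]-span of the image of [S] in [F'] stands in for the base change of [S] to [Rh]. The map
    [G] on it, scaled to send 1 to 1 and restricted to [S], is the [R]-linear map [S -> Rh] required
    by [retraction_descends]. *)
Lemma splinter_of_henselization (R Rh : comNzRingType) (phi : {rmorphism R -> Rh}) :
  noetherian R -> units_local R -> is_henselization phi -> splinter Rh -> splinter R.
Proof.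
move=> noeth lR hphi spl S kap kfin ksp.
have lRh : units_local Rh by case: hphi => -[/is_localP].
have spl1 := splinter_splinter_at spl.
have domRh : is_domain Rh by apply: splinter_at_domain spl1.
have [F [e einj]] := frac_embedding domRh.
have P0 := zero_prime_ideal (@field_is_domain F).
have [Q [pQ QE]] := ksp _ (prime_preimage (e \o phi) P0).
have [|F' [k [iota iotaE]]] := @extend_to_finite _ _ _ kap (e \o phi) Q kfin pQ.
  by move=> x; rewrite -QE.
have [s sgen] := kfin; pose l : {rmorphism Rh -> F'} := k \o e.
have linj : injective l by apply: inj_comp einj; apply: fmorph_inj.
have ispan t : lspan l (map iota s) (iota t).
  have [c ->] := sgen t; rewrite rmorph_sum; apply: lspan_sum => i.
  rewrite rmorphM iotaE; apply: (lspanZ (k := l)); apply: mem_lspan.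
  by apply: map_f; apply: mem_nth.
have sg : subalg_gen l (map iota s).
  split; first by rewrite -(rmorph1 iota).
  by move=> _ _ /mapP[x _ ->] /mapP[y _ ->]; rewrite -rmorphM.
have [G [GD GZ [u Gu]]] := splinter_at_subalg spl1 linj sg.
apply: (retraction_descends (phi := phi) (g := fun t => u * G (iota t))) => // [x y|r x|].
- by rewrite rmorphD GD // mulrDr.
- by rewrite rmorphM iotaE (GZ (phi r)) // mulrCA.
- by rewrite rmorph1 mulrC.
Qed.

(** * Adjoining a simple root *)

Lemma coef_comp_scaleX (A : comNzRingType) (p : {poly A}) (u : A) i :
  (p \Po (u *: 'X))`_i = p`_i * u ^+ i.
Proof.
elim/poly_ind: p i => [|p c IH] i; first by rewrite comp_poly0 !coef0 mul0r.
rewrite comp_poly_MXaddC -scalerAr !coefD coefZ !coefMX !coefC IH.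
case: i => [|i] /=; first by rewrite mulr0 expr0 mulr1.
by rewrite !addr0 exprS mulrCA.
Qed.

Lemma eval_map_comp_scaleX (A B : comNzRingType) (f : {rmorphism A -> B}) (b : B)
    (u : A) (p : {poly A}) :
  eval_map f b (p \Po (u *: 'X)) = eval_map f (f u * b) p.
Proof.
by rewrite !eval_mapE map_comp_poly horner_comp map_polyZ map_polyX hornerZ hornerX.
Qed.

(* Substituting [X := u X] turns a polynomial with leading coefficient [u] into a
   monic one: [g (u X) = u ^ n P] where [n + 1] is the degree of [P]. *)
Lemma monic_rescaling (A B : comNzRingType) (f : {rmorphism A -> B}) (P : {poly A})
    (u : A) (b : B) :
  is_unit (f u) -> (1 < size P)%N -> lead_coef P = u -> eval_map f b P = 0 ->
  is_unit (eval_map f b P^`()) ->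
  exists g : {poly A}, [/\ g \is monic, size g = size P, eval_map f (f u * b) g = 0
    & is_unit (eval_map f (f u * b) g^`())].
Proof.
move=> uu sP lP Pb uP'.
have [n nE] : exists n, size P = n.+2 by case: (size P) sP => [|[|n]] // _; exists n.
pose g := \poly_(i < n.+2) (if i == n.+1 then 1 else P`_i * u ^+ (n - i)).
have gn : g`_n.+1 = 1 by rewrite coef_poly ltnSn eqxx.
have sg : size g = n.+2.
  apply/eqP; rewrite eqn_leq size_poly /= ltnNge; apply/negP => /leq_sizeP/(_ _ (leqnn _)).
  by rewrite gn; apply/eqP/oner_neq0.
have gP : g \Po (u *: 'X) = u ^+ n *: P.
  apply/polyP => i; rewrite coef_comp_scaleX coefZ coef_poly.
  have [ilt|ige] := ltnP i n.+2; last first.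
    by rewrite mul0r nth_default ?nE // mulr0.
  case: eqVneq => [->|ine].
    have -> : P`_n.+1 = u by rewrite -lP lead_coefE nE.
    by rewrite mul1r exprSr.
  rewrite -mulrA -exprD subnK 1?mulrC //.
  by move: ilt; rewrite ltnS leq_eqVlt (negbTE ine).
have fun1 : is_unit (f (u ^+ n)) by rewrite rmorphXn; apply: unit_exp.
exists g; split; rewrite ?nE //.
- by rewrite monicE lead_coefE sg gn.
- by rewrite -eval_map_comp_scaleX gP eval_mapZ Pb mulr0.
have e : eval_map f b (g \Po (u *: 'X))^`() = eval_map f b (u ^+ n *: P)^`().
  by rewrite gP.
rewrite deriv_comp !derivZ derivX rmorphM eval_map_comp_scaleX eval_mapZ in e.
apply: (@unit_mull _ _ (eval_map f b (u *: 1))).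
by rewrite e; apply: unit_mul.
Qed.

Lemma prod_XsubC_coef_lspan (C B : comNzRingType) (k : {rmorphism C -> B}) (s rs : seq B) :
  subalg_gen k s -> (forall a, a \in rs -> lspan k s a) ->
  forall i, lspan k s (\prod_(a <- rs) ('X - a%:P))`_i.
Proof.
move=> sg; elim: rs => [|a rs IH] ars i.
  rewrite big_nil coef1; case: (i == 0)%N; last exact: lspan0.
  by case: sg.
have {}IH j : lspan k s (\prod_(a <- rs) ('X - a%:P))`_j.
  by apply: IH => b brs; apply: ars; rewrite in_cons brs orbT.
rewrite big_cons mulrBl coefB coefXM coefCM; apply: lspanB.
  by case: (i == 0)%N; [exact: lspan0|exact: IH].
by apply: subalg_genM => //; apply: ars; rewrite mem_head.
Qed.

(** This is the normality of splinters. If [x] is in the span and [l x = p] with [l] and [p] in [C],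
    then [l G(x) = p G(1)] by linearity, so [G(1) x = G(x)] is in [C]. Thus [u = G 1] is a
    denominator that does not depend on [h]. *)
Lemma splinter_at_clear_denominators (C L : comNzRingType) (pi : {rmorphism C -> L})
    (F : fieldType) (psi : {rmorphism C -> F}) (s : seq F) :
  splinter_at pi -> injective psi -> subalg_gen psi s ->
  exists u, is_unit (pi u) /\ forall (h : {poly F}) (l : C) (p : {poly C}),
    l <> 0 -> (forall i, lspan psi s h`_i) -> psi l *: h = map_poly psi p ->
    exists P, map_poly psi P = psi u *: h.
Proof.
move=> spl psiinj sg; have [G [GD GZ Gu]] := splinter_at_subalg spl psiinj sg.
exists (G 1); split=> // h l p l0 hs hp.
have s1 : lspan psi s 1 by case: sg.
have psil0 : psi l != 0 by rewrite -(rmorph0 psi) (inj_eq psiinj); apply/eqP.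
have GE i : psi (G h`_i) = psi (G 1) * h`_i.
  apply: (mulfI psil0); rewrite -rmorphM -GZ // mulrCA.
  have -> : psi l * h`_i = psi p`_i * 1.
    by rewrite mulr1 -coef_map -hp coefZ.
  by rewrite GZ // rmorphM mulr1 mulrC.
exists (\poly_(i < size h) G h`_i); apply/polyP => i.
rewrite coef_map coef_poly coefZ -GE.
have [//|ge] := ltnP i (size h).
by rewrite GE (nth_default _ ge) mulr0; apply: rmorph0.
Qed.

(** A polynomial [q] of least size killing [a] need not have a leading coefficient that is
    invertible in [L]. Its monic multiple over the fraction field does come from [C] after
    multiplication by the denominator [u], which is invertible in [L]; rescaling by [u] then makes
    it monic. *)
Lemma splinter_at_minimal_polynomial (C L : comNzRingType) (pi : {rmorphism C -> L})
    (f : {poly C}) (a : L) :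
  units_local L -> injective pi -> splinter_at pi -> f \is monic ->
  eval_map pi a f = 0 -> is_unit (eval_map pi a f^`()) ->
  exists (s : C) (g : {poly C}), [/\ is_unit (pi s), g \is monic,
    eval_map pi (pi s * a) g = 0, is_unit (eval_map pi (pi s * a) g^`())
    & forall p, eval_map pi (pi s * a) p = 0 -> exists w, p = w * g].
Proof.
move=> lL piinj spl fm fa uf'.
have domC := splinter_at_domain lL piinj spl.
have [F0 [e einj]] := frac_embedding domC.
have [F [k [rs rsE]]] := exists_splitting_extension (monic_map e fm).
have {e k einj rsE} [psi [psiinj rsE]] : exists psi : {rmorphism C -> F},
    injective psi /\ map_poly psi f = \prod_(a <- rs) ('X - a%:P).
  exists (k \o e); split; last by rewrite map_poly_comp.
  by apply: inj_comp einj; apply: fmorph_inj.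
have [q [q0 qa qmin qdiv]] := @ideal_minimal_poly C _ (kernel_is_ideal (eval_map pi a))
  (ex_intro2 _ _ f fa (monic_neq0 fm)).
have [m [w wE]] := qdiv f fa.
set l := lead_coef q in wE.
have l0 : l <> 0 by apply/eqP; rewrite lead_coef_eq0.
have psi0 x : psi x = 0 -> x = 0 by rewrite -(rmorph0 psi) => /psiinj.
have psil0 : psi l != 0 by apply/eqP => /psi0.
have lm0 : l ^+ m <> 0 by apply: domain_exp.
have psilm0 : psi (l ^+ m) != 0 by apply/eqP => /psi0.
have [wpsi] : exists w, psi (l ^+ m) *: map_poly psi f = w * map_poly psi q.
  by exists (map_poly psi w); rewrite -map_polyZ wE rmorphM.
move=> wpsiE.
(* Over [F] the roots of [q] are some of those of [f]. The complementary factors [q1] and [q2] thus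
   have coefficients that are polynomials in the roots, hence integral over [C], and are fractions
   over [C]. *)
have : map_poly psi q %| map_poly psi f.
  by rewrite -(dvdpZr _ _ psilm0) wpsiE dvdp_mull.
rewrite rsE => /dvdp_prod_XsubC[ms qms].
have [rs2 rsperm] := perm_to_subseq (mask_subseq ms rs).
set q1 := \prod_(i <- mask ms rs) _ in qms.
pose q2 := \prod_(b <- rs2) ('X - b%:P).
have fq12 : map_poly psi f = q1 * q2 by rewrite rsE (perm_big _ rsperm) big_cat.
have q1m : q1 \is monic by apply: monic_prod_XsubC.
have q1E : map_poly psi q = psi l *: q1.
  have /eqpP[[c1 c2] /andP[c10 c20] cE] := qms.
  have lE : c2 = c1 * psi l.
    have /(congr1 lead_coef) := cE.
    rewrite !lead_coefZ (monicP q1m) mulr1 lead_coef_map_eq //.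
  by apply: (scalerI c10); rewrite cE lE scalerA.
have [s [sg sU]] : exists s, subalg_gen psi s /\ forall b x, b \in rs -> x = b -> lspan psi s x.
  apply: (subalg_gen_bigjoin (U := fun b x => x = b)) => b brs.
  have [|s [sg sE]] := @subalg_gen_powers _ _ psi b f fm.
    by rewrite eval_mapE rsE; apply/rootP; rewrite root_prod_XsubC.
  by exists s; split=> // x ->; apply/sE; exists 'X; rewrite eval_mapX.
have [u [uu clear]] := splinter_at_clear_denominators spl psiinj sg.
have srs t i : {subset t <= rs} -> lspan psi s (\prod_(b <- t) ('X - b%:P))`_i.
  by move=> trs; apply: prod_XsubC_coef_lspan => // b /trs brs; apply: sU brs _.
have [P1 P1E] : exists P, map_poly psi P = psi u *: q1.
  apply: (clear _ l q) => // i; apply: srs; exact: mem_subseq (mask_subseq _ _).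
have [P2 P2E] : exists P, map_poly psi P = psi u *: q2.
  apply: (clear _ (l ^+ m) (l *: w)) => // [i|].
    by apply: srs => b b2; rewrite (perm_mem rsperm) mem_cat b2 orbT.
  apply: (mulfI (monic_neq0 q1m)); rewrite -scalerAr -fq12 map_polyZ -scalerAr scalerAl.
  by rewrite -q1E -map_polyZ wE rmorphM mulrC.
have mapinj : injective (map_poly psi) by apply: map_inj_poly; rewrite ?rmorph0.
have P12 : u ^+ 2 *: f = P1 * P2.
  apply: mapinj; rewrite map_polyZ [map_poly psi (P1 * P2)]rmorphM /= P1E P2E fq12.
  rewrite -scalerAl -scalerAr scalerA.
  by rewrite rmorphXn expr2.
have uq : u *: q = l *: P1.
  by apply: mapinj; rewrite !map_polyZ P1E q1E !scalerA mulrC.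
(* [L] is not yet known to be a domain, so the vanishing of the product of the two values decides
   nothing. The product rule does: the derivative is a unit, so one of the two values is a unit, and
   it is not that of [P1], because [u q = l P1] and [q] kills [a]. *)
have [P1a P1a' uP2] : [/\ eval_map pi a P1 = 0, is_unit (eval_map pi a P1^`())
    & is_unit (eval_map pi a P2)].
  have e0 : eval_map pi a P1 * eval_map pi a P2 = 0.
    by rewrite -rmorphM -P12 eval_mapZ fa mulr0.
  have : is_unit (eval_map pi a (u ^+ 2 *: f)^`()).
    by rewrite derivZ eval_mapZ rmorphXn; apply: unit_mul => //; apply: unit_exp.
  rewrite P12 derivM rmorphD !rmorphM => /lL.2[u1|/unit_mull u1].
    have u2 := unit_mulr u1; split=> //; last exact: unit_mull u1.
    by apply: (unit_mul_eq0 u2); rewrite mulrC.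
  case: l0; apply: piinj; rewrite rmorph0; apply: (unit_mul_eq0 u1).
  by rewrite mulrC -eval_mapZ -uq eval_mapZ qa mulr0.
have u0 : u <> 0.
  by move=> u0; case: lL => n0 _; apply: n0; rewrite -(rmorph0 pi) -u0.
have psiu0 : psi u != 0 by apply/eqP => /psi0.
have sP1 : size P1 = size q.
  rewrite -(size_map_inj_poly psiinj (rmorph0 psi)) P1E size_scale //.
  by rewrite -(size_map_inj_poly psiinj (rmorph0 psi) q) q1E size_scale.
have lP1 : lead_coef P1 = u.
  apply: (psiinj); rewrite -(lead_coef_map_inj psiinj (rmorph0 psi)).
  by rewrite P1E lead_coefZ (monicP q1m) mulr1.
have P1gt1 : (1 < size P1)%N.
  rewrite ltnNge; apply/negP => /size1_polyC P1C; apply: u0.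
  have P10 : P1`_0 = 0 by apply: piinj; rewrite rmorph0 -(eval_mapC pi a) -P1C.
  by rewrite -lP1 P1C P10 lead_coef0.
have [g [gm sgE ga ug']] := monic_rescaling uu P1gt1 lP1 P1a P1a'.
exists u, g; split=> // p pa.
exists (Pdiv.CommonRing.rdivp p g).
have pE := Pdiv.RingMonic.rdivp_eq gm p.
set r := Pdiv.CommonRing.rmodp p g in pE.
have ra : eval_map pi (pi u * a) r = 0.
  by move: pa; rewrite pE rmorphD rmorphM ga mulr0 add0r.
(* After the substitution [X := u X] the remainder kills [a] and is shorter than [q]. *)
have r0 : r \Po (u *: 'X) = 0.
  apply: qmin; first by rewrite eval_map_comp_scaleX.
  rewrite -sP1 -sgE; apply: leq_ltn_trans (Pdiv.CommonRing.ltn_rmodpN0 p (monic_neq0 gm)).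
  by apply/leq_sizeP => i ri; rewrite coef_comp_scaleX nth_default // mul0r.
suff r_0 : r = 0 by rewrite [LHS]pE r_0 addr0.
apply/polyP => i; have := congr1 (fun p : {poly C} => p`_i) r0.
rewrite /= coef_comp_scaleX !coef0 => /domC[//|ui].
by case: (@domain_exp _ u i domC u0).
Qed.

Lemma drop_polyS (A : comNzRingType) (g : {poly A}) j :
  'X * drop_poly j.+1 g = drop_poly j g - (g`_j)%:P.
Proof.
apply/polyP => i; rewrite coefXM coefB !coef_drop_poly coefC.
by case: i => [|i] /=; rewrite ?add0n ?subrr // subr0 addSnnS.
Qed.

(** The sum is the quotient of [g - g(a)] by [X - a], arranged by powers of [a]; the tails
    [drop_poly] are those of Horner's scheme. *)
Lemma telescope_drop_poly (A : comNzRingType) (g : {poly A}) (a : A) :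
  ('X - a%:P) * (\sum_(j < size g) a ^+ j *: drop_poly j.+1 g) = g - (g.[a])%:P.
Proof.
rewrite mulrBl mulr_sumr.
under eq_bigr do rewrite -scalerAr drop_polyS scalerBr.
rewrite sumrB mul_polyC scaler_sumr.
under [X in _ - X]eq_bigr do rewrite scalerA -exprS.
have gE : g.[a]%:P = \sum_(j < size g) a ^+ j *: (g`_j)%:P.
  rewrite horner_coef rmorph_sum; apply: eq_bigr => j _.
  by rewrite -mul_polyC -polyCM mulrC.
rewrite -gE addrAC; congr (_ - _).
have -> : \sum_(j < size g) a ^+ j *: drop_poly j g =
    g + \sum_(j < size g) a ^+ j.+1 *: drop_poly j.+1 g.
  transitivity (\sum_(j < (size g).+1) a ^+ j *: drop_poly j g).
    by rewrite big_ord_recr /= drop_poly_eq0 // scaler0 addr0.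
  by rewrite big_ord_recl expr0 scale1r drop_poly0l.
by rewrite addrK.
Qed.

(** This is the product rule for a product of linear factors. [H] is pinned down by its product with
    [X - a], which makes sense for repeated roots too. *)
Lemma sum_div_XsubC (F : fieldType) (rs : seq F) (H : F -> {poly F}) :
  (forall a, a \in rs -> ('X - a%:P) * H a = \prod_(b <- rs) ('X - b%:P)) ->
  \sum_(a <- rs) H a = (\prod_(b <- rs) ('X - b%:P))^`().
Proof.
elim: rs H => [|b rs IH] H HE; first by rewrite !big_nil derivC.
pose K a := (\prod_(b <- rs) ('X - b%:P)) %/ ('X - a%:P).
have KE a : a \in rs -> ('X - a%:P) * K a = \prod_(b <- rs) ('X - b%:P).
  by move=> ars; rewrite mulrC divpK // dvdp_XsubCl root_prod_XsubC.
rewrite !big_cons derivM derivXsubC mul1r -(IH K KE).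
congr (_ + _).
  apply: (mulfI (negbT (polyXsubC_eq0 b))).
  by rewrite HE ?mem_head // big_cons.
rewrite mulr_sumr big_seq [RHS]big_seq; apply: eq_bigr => a ars.
apply: (mulfI (negbT (polyXsubC_eq0 a))).
by rewrite HE ?in_cons ?ars ?orbT // big_cons mulrCA KE.
Qed.

(** The inner sum is symmetric in [a] and [c]: it is the difference quotient of [g] between them. As
    [g(a) = 0], it is also the value at [c] of [g / (X - a)], and these quotients add up to the
    derivative. *)
Lemma sum_drop_poly_roots (F : fieldType) (rs : seq F) (g : {poly F}) (c : F) :
  g = \prod_(a <- rs) ('X - a%:P) ->
  \sum_(a <- rs) \sum_(j < size g) a ^+ j * (drop_poly j.+1 g).[c] = g^`().[c].
Proof.
move=> gE; rewrite [in RHS]gE.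
rewrite -(@sum_div_XsubC _ _ (fun a => \sum_(j < size g) a ^+ j *: drop_poly j.+1 g)).
  rewrite horner_sum; apply: eq_bigr => a _.
  by rewrite horner_sum; apply: eq_bigr => j _; rewrite hornerZ.
move=> a ars; rewrite telescope_drop_poly -gE.
have /rootP -> : root g a by rewrite gE root_prod_XsubC.
by rewrite subr0.
Qed.

(** Each index enlarges the field; the maps found earlier are composed with the new extension, so
    that all of them end in one field. *)
Lemma extend_all_to_finite (C : comNzRingType) (T : comPzRingType) (F : fieldType)
    (kap : {rmorphism C -> T}) (J : eqType) (r : seq J) (psi : J -> {rmorphism C -> F}) :
  finite_map kap -> spec_surjective kap ->
  exists (F' : fieldType) (k : {rmorphism F -> F'}), forall j, j \in r ->
    exists iota : {rmorphism T -> F'}, forall x, iota (kap x) = k (psi j x).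
Proof.
move=> kfin ksp; elim: r => [|j r [F1 [k1 IH]]]; first by exists F, idfun.
have P0 := zero_prime_ideal (@field_is_domain F1).
have [Q [pQ QE]] := ksp _ (prime_preimage (k1 \o psi j) P0).
have [|F2 [k2 [iota iotaE]]] := @extend_to_finite _ _ _ kap (k1 \o psi j) Q kfin pQ.
  by move=> x; rewrite -QE.
exists F2, (k2 \o k1) => i; rewrite in_cons => /orP[/eqP ->|/IH[iota1 iota1E]].
  by exists iota.
by exists (k2 \o iota1) => x; rewrite /= iota1E.
Qed.

(* Let [C'] be free over [C] with basis the powers [b ^ j], [j < d]. The functional
   sending [b ^ (d - 1)] to [1] and the lower powers to [0] generates Hom_C(C', C), and
   for it the values of [drop_poly j.+1 g] at [b] form the basis dual to the powers of
   [b]. So [F] below is the [C']-linear map whose composite with the functional is [G]. *)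
Lemma linear_of_dual_basis (C C' : comNzRingType) (T : comPzRingType)
    (i : {rmorphism C -> C'}) (kap : {rmorphism C' -> T}) (G : T -> C) (b : C')
    (g : {poly C}) :
  (forall y z, G (y + z) = G y + G z) -> (forall r y, G (kap (i r) * y) = r * G y) ->
  eval_map i b g = 0 -> (forall c, exists r, c = eval_map i b r) ->
  let F t := \sum_(j < size g) i (G (kap b ^+ j * t)) * eval_map i b (drop_poly j.+1 g) in
  (forall y z, F (y + z) = F y + F z) /\ (forall c y, F (kap c * y) = c * F y).
Proof.
move=> GD GZ gb Cgen F.
have G0 : G 0 = 0 by apply: (addrI (G 0)); rewrite -GD !addr0.
have FD y z : F (y + z) = F y + F z.
  rewrite /F -big_split; apply: eq_bigr => j _.
  by rewrite mulrDr GD rmorphD mulrDl.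
have FZ c y : F (kap (i c) * y) = i c * F y.
  rewrite /F mulr_sumr; apply: eq_bigr => j _.
  by rewrite mulrCA GZ rmorphM mulrA.
(* Multiplication by [b] shifts the index of the sum by one, as [b B(j + 1) = B(j) - g_j]. The terms
   in [g_j] add up to the value of [G] at [g(b) y = 0], and the boundary terms vanish since
   [B(0) = g(b) = 0] and the tail at [size g] is 0. *)
have Fb y : F (kap b * y) = b * F y.
  pose B j := eval_map i b (drop_poly j g).
  have bB j : b * B j.+1 = B j - i g`_j.
    by rewrite /B -{1}(eval_mapX i b) -rmorphM drop_polyS rmorphB eval_mapC.
  have gE : \sum_(j < size g) i (G (kap b ^+ j * y)) * i g`_j = 0.
    transitivity (i (G (kap (eval_map i b g) * y))); last first.
      by rewrite gb rmorph0 mul0r G0 rmorph0.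
    rewrite eval_mapE (horner_coef_wide _ (size_poly _ _)) rmorph_sum mulr_suml.
    rewrite (big_morph G GD G0) rmorph_sum; apply: eq_bigr => j _.
    by rewrite coef_map rmorphM rmorphXn -mulrA GZ rmorphM mulrC.
  pose x j := i (G (kap b ^+ j * y)).
  have -> : b * F y = \sum_(j < size g) x j * B j.
    transitivity (\sum_(j < size g) x j * B j - \sum_(j < size g) x j * i g`_j).
      by rewrite -sumrB mulr_sumr; apply: eq_bigr => j _; rewrite mulrCA bB mulrBr.
    by rewrite gE subr0.
  have -> : F (kap b * y) = \sum_(j < size g) x j.+1 * B j.+1.
    by apply: eq_bigr => j _; rewrite mulrA -exprSr.
  transitivity (\sum_(j < (size g).+1) x j * B j).
    by rewrite big_ord_recl {2}/B drop_poly0l gb mulr0 add0r.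
  by rewrite big_ord_recr /= /B drop_poly_eq0 // rmorph0 mulr0 addr0.
split=> // c y; have [r ->] := Cgen c.
have F0 : F 0 = 0 by apply: (addrI (F 0)); rewrite -FD !addr0.
elim/poly_ind: r => [|r a IH]; first by rewrite !rmorph0 !mul0r.
rewrite !rmorphD !rmorphM eval_mapX eval_mapC !mulrDl FD FZ; congr (_ + _).
by rewrite -mulrA mulrCA Fb IH mulrCA mulrA.
Qed.

(** For a single root the value of [G] at the image of [hb] need not be a unit. The sum over all
    roots lies in [C], where [G] is multiplication by [G 1]; this is why [T] is mapped once for each
    root into the same field. *)
Lemma splinter_at_adjoin_root (C L : comNzRingType) (pi : {rmorphism C -> L})
    (g : {poly C}) (b : L) (b0 : C) :
  units_local L -> injective pi -> splinter_at pi -> g \is monic ->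
  eval_map pi b g = 0 -> is_unit (eval_map pi b g^`()) ->
  (forall p, eval_map pi b p = 0 -> exists w, p = w * g) -> ~ is_unit (b - pi b0) ->
  exists (C' : comNzRingType) (pi' : {rmorphism C' -> L}) (i : {rmorphism C -> C'})
    (b' : C'),
    [/\ injective pi', splinter_at pi', forall c, pi' (i c) = pi c & pi' b' = b].
Proof.
move=> lL piinj spl gm gb ug' gmin nbb0.
have domC := splinter_at_domain lL piinj spl.
have [s0 [sg0 s0E]] := subalg_gen_powers gm gb.
have [C' [pi' [i [pi'inj pi'i ifin s0im]]]] := subalg_type sg0.
have [b' b'E] : exists b', pi' b' = b.
  by apply/s0im/s0E; exists 'X; rewrite eval_mapX.
exists C', pi', i, b'; split=> // T kap kfin ksp.
have evE r : pi' (eval_map i b' r) = eval_map pi b r.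
  by rewrite (eval_map_rmorph (h := pi)) ?b'E.
have Cgen c : exists r, c = eval_map i b' r.
  have [r rE] : exists r, pi' c = eval_map pi b r by apply/s0E/s0im; exists c.
  by exists r; apply: pi'inj; rewrite rE evE.
have gb' : eval_map i b' g = 0 by apply: pi'inj; rewrite evE gb rmorph0.
have [F0 [e einj]] := frac_embedding domC.
have [F1 [k1 [rs rsE]]] := exists_splitting_extension (monic_map e gm).
have {e k1 einj rsE} [psi [psiinj rsE]] : exists psi : {rmorphism C -> F1},
    injective psi /\ map_poly psi g = \prod_(a <- rs) ('X - a%:P).
  exists (k1 \o e); split; last by rewrite map_poly_comp.
  by apply: inj_comp einj; apply: fmorph_inj.
(* By [gmin], evaluation at [b'] has kernel generated by [g], so [b'] may be sent to any root of
   [g]. *)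
have /choice[psi_ psi_E] (j : 'I_(size rs)) : exists f : {rmorphism C' -> F1},
    forall r, f (eval_map i b' r) = eval_map psi rs`_j r.
  apply: (rmorphism_factor (p := eval_map i b')) => [c|r rb'].
    by have [r ->] := Cgen c; exists r.
  have [|w ->] := gmin r; first by rewrite -evE rb' rmorph0.
  have gj : eval_map psi rs`_j g = 0.
    by rewrite eval_mapE rsE; apply/rootP; rewrite root_prod_XsubC mem_nth.
  by rewrite rmorphM gj mulr0.
have [F' [k kE]] := extend_all_to_finite (enum 'I_(size rs)) psi_ kfin ksp.
have /choice[iota iotaE] (j : 'I_(size rs)) : exists f : {rmorphism T -> F'},
    forall x, f (kap x) = k (psi_ j x) by apply: kE; rewrite mem_enum.
pose l : {rmorphism C -> F'} := k \o psi.
have linj : injective l by apply: inj_comp psiinj; apply: fmorph_inj.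
have iotal j c : iota j (kap (i c)) = l c.
  by rewrite iotaE -(eval_mapC i b') psi_E eval_mapC.
have [s [sg sU]] : exists s, subalg_gen l s /\
    forall j x, j \in enum 'I_(size rs) -> (exists t, x = iota j t) -> lspan l s x.
  apply: (subalg_gen_bigjoin (U := fun j x => exists t, x = iota j t)) => j _.
  have [t [tg tE]] := subalg_gen_image (finite_map_comp ifin kfin) (iotal j).
  by exists t; split=> // x /tE.
have siota j t : lspan l s (iota j t) by apply: (sU j); rewrite ?mem_enum //; exists t.
have [G [GD GZ Gu]] := splinter_at_subalg spl linj sg.
have s1 : lspan l s 1 by case: sg.
have G0 : G 0 = 0 by apply: (addrI (G 0)); rewrite -GD ?addr0 //; apply: lspan0.
(* [hb] is the value at [b'] of [(g - g b0) / (X - b0)]. *)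
pose hb := \sum_(j < size g) b' ^+ j * i (drop_poly j.+1 g).[b0].
have sumh : \sum_(j < size rs) iota j (kap hb) = l g^`().[b0].
  transitivity (k (\sum_(a <- rs) \sum_(j < size (map_poly psi g))
      a ^+ j * (drop_poly j.+1 (map_poly psi g)).[psi b0])).
    rewrite (big_nth 0) big_mkord [in RHS]rmorph_sum; apply: eq_bigr => j _.
    rewrite iotaE size_map_inj_poly ?rmorph0 //; congr (k _).
    rewrite /hb rmorph_sum; apply: eq_bigr => m _.
    rewrite rmorphM rmorphXn -(eval_mapX i b') psi_E eval_mapX.
    rewrite -(eval_mapC i b') psi_E eval_mapC; congr (_ * _).
    rewrite -horner_map; congr (_.[_]); apply/polyP => n.
    by rewrite coef_map !coef_drop_poly coef_map.
  by rewrite (sum_drop_poly_roots _ rsE) deriv_map horner_map.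
have ub : is_unit (pi g^`().[b0]).
  apply: (@local_sub_unit _ _ (eval_map pi b g^`())) => //.
  rewrite -horner_map eval_mapE -opprB => /unit_opp; rewrite opprK.
  exact: local_horner_sub.
(* The values of [G] add up to [G 1] times the derivative of [g] at [b0], a unit in [L]; as [L] is
   local, one of them is a unit. *)
have [j _ uj] : exists2 j, j \in enum 'I_(size rs) & is_unit (pi (G (iota j (kap hb)))).
  apply: (@local_sum_unit L _ (enum 'I_(size rs)) (fun j => pi (G (iota j (kap hb))))) => //.
  rewrite -rmorph_sum -(additive_sum (P := lspan l s)) //.
  - by rewrite big_enum sumh -[l _]mulr1 GZ // rmorphM; apply: unit_mul.
  - exact: lspan0.
  - by move=> x y; apply: lspanD.
pose Gj t := G (iota j t).
have GjD y z : Gj (y + z) = Gj y + Gj z by rewrite /Gj rmorphD GD.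
have GjZ r y : Gj (kap (i r) * y) = r * Gj y by rewrite /Gj rmorphM iotal GZ.
have := linear_of_dual_basis GjD GjZ gb' Cgen.
set F := fun t : T => _ => -[FD FZ]; exists F; split=> //.
(* [F 1] and [Gj (kap hb)] are the same combination of the tails of [g], evaluated at [b] and at
   [b0] respectively, so in [L] they differ by a multiple of the nonunit [b - pi b0]. *)
apply: (@local_sub_unit _ _ (pi (Gj (kap hb)))) => //.
have -> : pi (Gj (kap hb)) =
    \sum_(m < size g) pi (Gj (kap b' ^+ m * 1)) * pi (drop_poly m.+1 g).[b0].
  have Gj0 : Gj 0 = 0 by rewrite /Gj rmorph0.
  rewrite /hb rmorph_sum (big_morph Gj GjD Gj0) rmorph_sum; apply: eq_bigr => m _.
  by rewrite rmorphM mulrC GjZ rmorphM mulrC rmorphXn mulr1.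
rewrite /F rmorph_sum -sumrB.
have /choice[w wE] (m : 'I_(size g)) : exists w, eval_map pi b (drop_poly m.+1 g) -
    pi (drop_poly m.+1 g).[b0] = (b - pi b0) * w.
  by rewrite -horner_map eval_mapE; apply: horner_sub_dvd.
under eq_bigr => m _.
  rewrite rmorphM pi'i evE -mulrBr wE mulrCA.
  over.
by rewrite -mulr_sumr => /unit_mull.
Qed.

(** * The Henselization as a union of finite models *)

(** Fractions over [C] with denominator invertible in [L]; for local [L] and injective [pi], the
    localization of [C] at the contraction of the maximal ideal. *)
Definition in_localization (C L : comNzRingType) (pi : {rmorphism C -> L}) (x : L) :=
  exists u s, is_unit (pi s) /\ pi s * x = pi u.

Lemma in_localization_image (C L : comNzRingType) (pi : {rmorphism C -> L}) c :
  in_localization pi (pi c).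
Proof. by exists c, 1; rewrite rmorph1 mul1r; split=> //; apply: unit1. Qed.

Lemma in_localizationB (C L : comNzRingType) (pi : {rmorphism C -> L}) x y :
  in_localization pi x -> in_localization pi y -> in_localization pi (x - y).
Proof.
move=> [u [s [us sx]]] [v [t [ut ty]]]; exists (t * u - s * v), (s * t).
rewrite rmorphB !rmorphM; split; first exact: unit_mul.
by rewrite -sx -ty; ring.
Qed.

Lemma in_localizationM (C L : comNzRingType) (pi : {rmorphism C -> L}) x y :
  in_localization pi x -> in_localization pi y -> in_localization pi (x * y).
Proof.
move=> [u [s [us sx]]] [v [t [ut ty]]]; exists (u * v), (s * t).
rewrite !rmorphM; split; first exact: unit_mul.
by rewrite -sx -ty mulrACA.
Qed.

Lemma in_localizationV (C L : comNzRingType) (pi : {rmorphism C -> L}) x y :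
  in_localization pi x -> x * y = 1 -> in_localization pi y.
Proof.
move=> [u [s [us sx]]] xy; exists s, u; split.
  by rewrite -sx; apply: unit_mul => //; exists y.
by rewrite -sx -mulrA xy mulr1.
Qed.

Lemma common_denominator (C L : comNzRingType) (pi : {rmorphism C -> L}) (J : finType)
    (x : J -> L) : (forall j, in_localization pi (x j)) ->
  exists s, is_unit (pi s) /\ forall j, exists u, pi s * x j = pi u.
Proof.
move=> /choice[u /choice[s usE]]; exists (\prod_j s j); split.
  rewrite rmorph_prod; elim/big_ind: _ => [|a b|j _]; first exact: unit1.
    exact: unit_mul.
  by case: (usE j).
move=> j; exists ((\prod_(l | l != j) s l) * u j).
rewrite (bigD1 j) //= !rmorphM -(usE j).2; ring.
Qed.

(* The subrings [C] of the Henselization along which the splinter property is carried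
   upwards; [splinter_at] makes them domains. *)
Definition good_model (R L : comNzRingType) (phi : {rmorphism R -> L})
    (C : comNzRingType) (pi : {rmorphism C -> L}) : Prop :=
  [/\ injective pi, splinter_at pi & forall r, in_localization pi (phi r)].

Definition dominates (L C C' : comNzRingType) (pi' : {rmorphism C' -> L})
    (pi : {rmorphism C -> L}) : Prop :=
  forall x, in_localization pi x -> in_localization pi' x.

(** The root is rescaled by units of [L]: by the common denominator [s] and then by the factor [t]
    from the minimal polynomial. The approximation follows, [a0] becoming [t * u0] with
    [pi u0 = pi s * a0]. *)
Lemma henselian_root_step (R C L : comNzRingType) (phi : {rmorphism R -> L})
    (pi : {rmorphism C -> L}) (f : {poly L}) (a a0 : L) :
  units_local L -> good_model phi pi -> f \is monic ->
  (forall j, in_localization pi f`_j) -> in_localization pi a0 ->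
  f.[a] = 0 -> is_unit f^`().[a] -> ~ is_unit (a - a0) ->
  exists (C' : comNzRingType) (pi' : {rmorphism C' -> L}),
    [/\ good_model phi pi', dominates pi' pi & in_localization pi' a].
Proof.
move=> lL [piinj spl piphi] fm floc a0loc fa uf' na.
(* [Some j] indexes the coefficients of [f], [None] the approximate root [a0]. *)
have [|s [us sE]] := @common_denominator C L pi (option 'I_(size f))
    (fun j => if j is Some j then f`_j else a0).
  by case.
have [u0 u0E] := sE None.
have /choice[c cE] (j : 'I_(size f)) := sE (Some j).
have sf : (1 < size f)%N.
  rewrite ltnNge; apply/negP => /size1_polyC fC.
  have f0 : f`_0 = 1 by rewrite -(monicP fm) [in RHS]fC lead_coefC.
  have f1 : f = 1 by rewrite fC f0.
  by move/eqP: fa; rewrite f1 hornerC oner_eq0.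
pose P := \poly_(j < size f) (if insub j is Some j' then c j' else 0).
have piP : map_poly pi P = pi s *: f.
  apply/polyP => j; rewrite coef_map coefZ coef_poly.
  case: ltnP => [jf|jf]; last by rewrite nth_default // mulr0; apply: rmorph0.
  by rewrite insubT /= -cE.
have pis0 : pi s != 0.
  by apply/eqP => pis0; case: lL => + _; apply; rewrite -pis0.
have sP : size P = size f.
  rewrite -(size_map_inj_poly piinj (rmorph0 pi)) piP.
  have lf : pi s * lead_coef f != 0 by rewrite (monicP fm) mulr1.
  by rewrite -mul_polyC size_proper_mul ?lead_coefC // size_polyC pis0.
have lP : lead_coef P = s.
  apply: (piinj); rewrite lead_coefE -coef_map piP coefZ sP -lead_coefE (monicP fm).
  by rewrite mulr1.
have Pa : eval_map pi a P = 0 by rewrite eval_mapE piP hornerZ fa mulr0.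
have uP' : is_unit (eval_map pi a P^`()).
  by rewrite eval_mapE -deriv_map piP derivZ hornerZ; apply: unit_mul.
have sP1 : (1 < size P)%N by rewrite sP.
have [g [gm _ ga ug']] := monic_rescaling us sP1 lP Pa uP'.
have [t [h [ut hm ha uh' hmin]]] :=
  splinter_at_minimal_polynomial lL piinj spl gm ga ug'.
have [|C' [pi' [i [b' [pi'inj spl' pi'i pi'b]]]]] :=
  @splinter_at_adjoin_root C L pi h _ (t * u0) lL piinj spl hm ha uh' hmin.
  by rewrite rmorphM -u0E -mulrBr -mulrBr => /unit_mulr/unit_mulr.
have dom : dominates pi' pi.
  by move=> x [u [v [uv vx]]]; exists (i u), (i v); rewrite !pi'i.
exists C', pi'; split=> //; first by split=> // r; apply: dom.
exists b', (i (t * s)); rewrite pi'i rmorphM; split; first exact: unit_mul.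
by rewrite pi'b mulrA.
Qed.

(* Asking for an enlargement of every good model makes these elements a subring:
   enlargements for two elements can be chained. *)
Definition eventually_localized (R L : comNzRingType) (phi : {rmorphism R -> L}) (x : L) :=
  forall (C : comNzRingType) (pi : {rmorphism C -> L}), good_model phi pi ->
  exists (C' : comNzRingType) (pi' : {rmorphism C' -> L}),
    [/\ good_model phi pi', dominates pi' pi & in_localization pi' x].

Lemma eventually_localized_seq (R L : comNzRingType) (phi : {rmorphism R -> L})
    (xs : seq L) (C : comNzRingType) (pi : {rmorphism C -> L}) :
  (forall x, x \in xs -> eventually_localized phi x) -> good_model phi pi ->
  exists (C' : comNzRingType) (pi' : {rmorphism C' -> L}),
    [/\ good_model phi pi', dominates pi' pi
      & forall x, x \in xs -> in_localization pi' x].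
Proof.
elim: xs C pi => [|x xs IH] C pi xsP gpi; first by exists C, pi; split.
have [|C1 [pi1 [g1 d1 l1]]] := IH C pi _ gpi.
  by move=> y ys; apply: xsP; rewrite in_cons ys orbT.
have [C2 [pi2 [g2 d2 l2]]] := xsP x (mem_head _ _) C1 pi1 g1.
exists C2, pi2; split=> // [y /d1/d2//|y].
by rewrite in_cons => /orP[/eqP ->|/l1/d2].
Qed.

(** The elements in question form a Henselian subring [D]: a root in [Rh] of a polynomial over [D]
    can itself be reached. The map [Rh -> D] from the universal property, followed by the inclusion,
    fixes the image of [R], so by uniqueness it is the identity and [D] is all of [Rh]. *)
Lemma henselization_eventually_localized (R Rh : comNzRingType)
    (phi : {rmorphism R -> Rh}) :
  units_local R -> is_henselization phi -> forall x, eventually_localized phi x.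
Proof.
move=> lR [[locRh hRh] philoc univ].
have lRh : units_local Rh by apply/is_localP.
pose E := eventually_localized phi.
have E2 x y z : (forall (C : comNzRingType) (pi : {rmorphism C -> Rh}),
    in_localization pi x -> in_localization pi y -> in_localization pi z) ->
    E x -> E y -> E z.
  move=> xyz Ex Ey C pi gpi.
  have [|C' [pi' [g' d' l']]] := @eventually_localized_seq _ _ _ [:: x; y] C pi _ gpi.
    by move=> w; rewrite !inE => /orP[] /eqP ->.
  by exists C', pi'; split=> //; apply: xyz; apply: l'; rewrite !inE eqxx ?orbT.
have EC c : E (phi c).
  by move=> C pi gpi; exists C, pi; split=> //; case: gpi.
have E1 : E 1 by rewrite -(rmorph1 phi).
have [D [v [vinj vE]]] := @subring_type Rh E E1
  (fun x y => @E2 x y _ (fun C pi => @in_localizationB _ _ pi x y))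
  (fun x y => @E2 x y _ (fun C pi => @in_localizationM _ _ pi x y)).
(* The localizations are stable under inverses taken in [Rh], so [D] inherits locality and its
   inclusion reflects units. *)
have uD d : is_unit d <-> is_unit (v d).
  split=> [|[y vdy]]; first exact: unit_rmorph.
  have Evd : E (v d) by apply/vE; exists d.
  have /vE[e eE] : E y.
    by apply: (E2 _ _ _ _ Evd Evd) => C pi lx _; apply: in_localizationV lx vdy.
  by exists e; apply: vinj; rewrite rmorphM eE vdy rmorph1.
have lD : units_local D.
  split=> [/uD|x y /uD]; first by rewrite rmorph0; case: lRh.
  by rewrite rmorphD => /lRh.2[] /uD; [left|right].
have hD : henselian D.
  split; first exact/is_localP.
  move=> f fm a0 nfa0 uf'a0.
  have vf (p : {poly D}) d : (map_poly v p).[v d] = v p.[d] by rewrite horner_map.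
  have [|||a [fa na]] := hRh (map_poly v f) _ (v a0).
  - exact: monic_map.
  - by rewrite vf => /uD.
  - by rewrite deriv_map vf; apply/uD.
  have /vE[d dE] : E a.
    move=> C pi gpi.
    have [|C1 [pi1 [g1 d1 l1]]] :=
        @eventually_localized_seq _ _ phi (v a0 :: map_poly v f) C pi _ gpi.
      move=> x; rewrite in_cons => /orP[/eqP ->|/(nthP 0)[j _ <-]].
        by apply/vE; exists a0.
      by rewrite coef_map; apply/vE; exists f`_j.
    have [||||C2 [pi2 [g2 d2 l2]]] :=
        @henselian_root_step _ _ _ phi pi1 (map_poly v f) a (v a0) lRh g1 _ _ _ fa _ na.
    - exact: monic_map.
    - move=> j; have [jlt|jge] := ltnP j (size (map_poly v f)).
        by apply: l1; rewrite in_cons mem_nth ?orbT.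
      by rewrite nth_default // -(rmorph0 pi1); apply: in_localization_image.
    - by apply: l1; rewrite mem_head.
    - apply: (@local_sub_unit _ _ (map_poly v f)^`().[v a0]) => //.
        exact: local_horner_sub.
      by rewrite deriv_map vf; apply/uD.
    by exists C2, pi2; split=> // x /d1/d2.
  exists d; split; first by apply: vinj; rewrite -vf dE fa rmorph0.
  by move=> /uD; rewrite rmorphB dE.
have /choice[f fE] (c : R) : exists d, v d = phi c by apply/vE.
have [phiD phiDE] : exists g : {rmorphism R -> D}, forall c, g c = f c.
  by apply: rmorphism_of_fun => [x y|x y|]; apply: vinj;
    rewrite ?rmorphD ?rmorphM ?rmorph1 !fE ?rmorphD ?rmorphM ?rmorph1.
have vphi c : v (phiD c) = phi c by rewrite phiDE fE.
have phiDloc : local_hom phiD by move=> c /uD; rewrite vphi => /philoc.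
have [[theta [thetaloc thetaE]] _] := univ D phiD hD phiDloc.
have [_ uniq] := univ Rh phi (conj locRh hRh) philoc.
move=> x; apply/vE; exists (theta x).
apply: (uniq (v \o theta) idfun) => // [y|c].
  by move=> /= /uD; apply: thetaloc.
by rewrite /= thetaE vphi.
Qed.

(** Elimination without division: [A] is not assumed Noetherian, so finitely many vectors generate
    [U] only up to nonzero multiples. A linear equation with values in a domain is insensitive to
    such a multiple. *)
Lemma finite_relations (A : comNzRingType) n (U : 'rV[A]_n -> Prop) :
  is_domain A -> is_submod U ->
  exists s : seq 'rV[A]_n, (forall v, v \in s -> U v) /\
    forall v, U v -> exists d, d <> 0 /\
      forall V : 'rV[A]_n -> Prop, is_submod V -> (forall w, w \in s -> V w) -> V (d *: v).
Proof.
move=> domA; elim: n U => [|n IH] U sU; have [U0 UD UZ] := sU.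
  exists [::]; split=> // v _; exists 1; split; first exact/eqP/oner_neq0.
  by move=> V [V0 _ _] _; rewrite thinmx0.
have [s [sU' sgen]] := IH _ (submod_row_cons0 sU).
have tlgen (v : 'rV[A]_n.+1) : v 0 ord0 = 0 -> U v -> exists d, d <> 0 /\
    forall V : 'rV[A]_n.+1 -> Prop, is_submod V ->
      (forall w, w \in map (@row_cons0 A n) s -> V w) -> V (d *: v).
  move=> /row_cons0E vE Uv; have [|d [d0 dE]] := sgen (rsubmx (v : 'rV_(1 + n))).
    by rewrite -vE.
  exists d; split=> // V sV Vs; rewrite vE -row_cons0Z.
  by apply: (dE _ (submod_row_cons0 sV)) => w ws; apply: Vs; apply: map_f.
(* One vector [r] with nonzero first coordinate suffices as a pivot: cross-multiplication with it
   cancels the first coordinate of any other vector. *)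
have [[r Ur r0]|nr] := pselect (exists2 r : 'rV[A]_n.+1, U r & r 0 ord0 <> 0); last first.
  exists (map (@row_cons0 A n) s); split=> [_ /mapP[w ws ->]|v Uv]; first exact: sU'.
  by apply: tlgen => //; apply: contrapT => v0; apply: nr; exists v.
exists (r :: map (@row_cons0 A n) s); split=> [w|v Uv].
  by rewrite in_cons => /orP[/eqP ->//|/mapP[w' ws ->]]; apply: sU'.
have [||d [d0 dE]] := tlgen (r 0 ord0 *: v - v 0 ord0 *: r).
- by rewrite !mxE mulrC subrr.
- by apply: submodB => //; apply: UZ.
exists (d * r 0 ord0); split; first by move=> /domA[].
move=> V sV Vs; have [V0 VD VZ] := sV.
have -> : (d * r 0 ord0) *: v =
    d *: (r 0 ord0 *: v - v 0 ord0 *: r) + (d * v 0 ord0) *: r.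
  by rewrite scalerBr !scalerA subrK.
apply: VD; last by apply: VZ; apply: Vs; rewrite mem_head.
by apply: dE => // w ws; apply: Vs; rewrite in_cons ws orbT.
Qed.

(** Structure constants of [D], coordinates of 1 and enough relations are finitely many elements of
    [L], so a single good model carries them all up to a denominator [s]. *)
Lemma retraction_of_good_models (R L : comNzRingType) (phi : {rmorphism R -> L})
    (D : comNzRingType) (kap : {rmorphism L -> D}) :
  units_local L -> (forall x, eventually_localized phi x) ->
  (exists (C : comNzRingType) (pi : {rmorphism C -> L}), good_model phi pi) ->
  is_domain L -> finite_map kap -> injective kap -> has_module_retraction kap.
Proof.
move=> lL evl [C0 [pi0 g0]] domL [t tgen] kapinj.
pose N := size t.
have /choice[c cE] (ij : 'I_N * 'I_N) : exists c : 'rV[L]_N,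
    t`_(ij.1) * t`_(ij.2) = \sum_l kap (c 0 l) * t`_l
  by apply: lspan_row.
have [u uE] := lspan_row (tgen 1).
pose rel (lam : 'rV[L]_N) := \sum_i kap (lam 0 i) * t`_i = 0.
have srel : is_submod rel by apply: kernel_submod.
have [rho [rhorel rhogen]] := finite_relations domL srel.
pose J : finType := ((('I_N * 'I_N) * 'I_N) + ('I_N + 'I_(size rho) * 'I_N))%type.
pose data (j : J) : L := match j with
  | inl (ij, l) => c ij 0 l | inr (inl i) => u 0 i | inr (inr (m, i)) => rho`_m 0 i end.
have [C [pi [[piinj spl _] _ dataloc]]] :=
  eventually_localized_seq (xs := [seq data j | j <- enum J]) (fun x _ => evl x) g0.
have [|s [us sE]] := @common_denominator C L pi J data.
  by move=> j; apply: dataloc; apply: map_f; rewrite mem_enum.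
have /choice[e eE] := sE.
pose k : {rmorphism C -> D} := kap \o pi.
have kinj : injective k by apply: inj_comp.
(* Scaling the generators by [s] multiplies the structure constants by [s], which brings them into
   [C]; so 1 and the [t' i] span a finite [C]-subalgebra. *)
pose t' i := k s * t`_i.
pose gens := 1 :: [seq t' i | i <- iota 0 N].
have kE j : k (e j) = k s * kap (data j) by rewrite /k /= -eE rmorphM.
have st' i : (i < N)%N -> lspan k gens (t' i).
  by move=> iN; apply: mem_lspan; rewrite in_cons map_f ?orbT // mem_iota.
have s1 : lspan k gens 1 by apply: mem_lspan; rewrite mem_head.
have sg : subalg_gen k gens.
  split=> // x y; rewrite !in_cons => /orP[/eqP ->|/mapP[i]].
    by rewrite mul1r => yg; apply: mem_lspan; rewrite in_cons.
  rewrite mem_iota add0n => /= iN ->{x} /orP[/eqP ->|/mapP[j]].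
    by rewrite mulr1; apply: st'.
  rewrite mem_iota add0n => /= jN ->{y}.
  pose ij := (Ordinal iN, Ordinal jN).
  have -> : t' i * t' j = \sum_l k (e (inl (ij, l))) * t' l.
    rewrite /t' mulrACA (cE ij) mulr_sumr; apply: eq_bigr => l _.
    by rewrite kE /=; ring.
  by apply: lspan_sum => l; apply: lspanZ; apply: st'.
have [F [FD FZ uF]] := splinter_at_subalg spl kinj sg.
have F0 : F 0 = 0 by apply: (addrI (F 0)); rewrite -FD ?addr0 //; apply: lspan0.
have Fsum (a : 'I_N -> C) : F (\sum_i k (a i) * t' i) = \sum_i a i * F (t' i).
  rewrite (additive_sum (P := lspan k gens)) //.
  - by apply: eq_bigr => i _; rewrite FZ //; apply: st'.
  - exact: lspan0.
  - by move=> x y; apply: lspanD.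
  - by move=> i; apply: lspanZ; apply: st'.
have [y yE] : is_unit (pi s * pi (F 1)) by apply: unit_mul.
(* [y] is the inverse of [s F(1)]: it undoes the scaling of the generators and normalizes the value
   at 1. *)
pose w := \row_(i < N) (y * pi (F (t' i))).
have datasum (a : 'I_N -> J) :
    pi s * \sum_i data (a i) * w 0 i = y * pi (F (k s * (k s * \sum_i kap (data (a i)) * t`_i))).
  have -> : k s * (k s * \sum_i kap (data (a i)) * t`_i) = \sum_i k (e (a i)) * t' i.
    by rewrite !mulr_sumr; apply: eq_bigr => i _; rewrite kE /t'; ring.
  rewrite Fsum rmorph_sum !mulr_sumr; apply: eq_bigr => i _.
  by rewrite mxE rmorphM -eE; ring.
apply: (linear_map_of_solution (u := u) (y := w)) => //; last first.
  apply: (unit_mulI us); rewrite (datasum (fun i => inr (inl i))) /= -uE mulr1.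
  have Fks : F (k s) = s * F 1 by rewrite -(mulr1 (k s)) FZ.
  rewrite FZ ?Fks; last exact: subalg_genC.
  rewrite !rmorphM mulr1 -[RHS]mulr1 -yE; ring.
move=> lam /rhogen[d [d0 dV]].
have sV := kernel_submod (idfun : {rmorphism L -> L}) (fun i => w 0 i).
have rhoV : forall v, v \in rho -> \sum_i v 0 i * w 0 i = 0.
  move=> v vrho; have vi : (index v rho < size rho)%N by rewrite index_mem.
  have vE : rho`_(index v rho) = v by rewrite nth_index.
  apply: (unit_mul_eq0 us).
  have := datasum (fun i => inr (inr (Ordinal vi, i))); rewrite /= vE => ->.
  by rewrite [\sum_i _]rhorel // !mulr0 F0 rmorph0 mulr0.
have := dV _ sV rhoV; under eq_bigr do rewrite mxE -mulrA.
by rewrite -mulr_sumr => /domL[].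
Qed.

(** A zero product in [Rh] is already visible in one good model, which is a domain; so [Rh] is a
    domain. Dividing [T] by a prime [Q] over the zero ideal makes the cover injective, and a
    retraction from [T / Q] gives one from [T]. *)
Lemma splinter_henselization (R Rh : comNzRingType) (phi : {rmorphism R -> Rh}) :
  noetherian R -> units_local R -> is_henselization phi -> splinter R -> splinter Rh.
Proof.
move=> noeth lR hphi spl T kap kfin ksp.
have lRh : units_local Rh by case: hphi => -[/is_localP].
have evl := henselization_eventually_localized lR hphi.
have gphi : good_model phi phi.
  split; first exact: henselization_inj hphi.
    move=> S k' k'fin k'sp; have [g [gD gZ g1]] := spl S k' k'fin k'sp.
    by exists g; split=> //; rewrite -(rmorph1 k') g1 rmorph1; apply: unit1.
  exact: in_localization_image.
have domRh : is_domain Rh.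
  move=> x y xy.
  have [C [pi [[piinj splpi _] _ loc]]] :=
    eventually_localized_seq (xs := [:: x; y]) (fun x _ => evl x) gphi.
  have [u [s [us sx]]] : in_localization pi x by apply: loc; rewrite !inE eqxx.
  have [v [t [ut ty]]] : in_localization pi y by apply: loc; rewrite !inE eqxx orbT.
  have domC := splinter_at_domain lRh piinj splpi.
  have /domC[e|e] : u * v = 0.
    by apply: piinj; rewrite rmorphM -sx -ty mulrACA xy mulr0 rmorph0.
  - by left; apply: (unit_mul_eq0 us); rewrite sx e rmorph0.
  - by right; apply: (unit_mul_eq0 ut); rewrite ty e rmorph0.
have [Q [[IQ Q1 QM] QE]] := ksp _ (zero_prime_ideal domRh).
have [D [q [qsurj qker]]] := quotient_nz IQ Q1.
have qkinj : injective (q \o kap).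
  by apply: rmorph_injP => x /qker/QE.
have [g [gD gZ g1]] : has_module_retraction (q \o kap).
  apply: (retraction_of_good_models lRh evl) => //; first by exists R, phi.
  exact: finite_map_quotient.
exists (g \o q); split=> [y z|r y|r] /=.
- by rewrite rmorphD gD.
- by rewrite rmorphM gZ.
- exact: g1.
Qed.

Theorem theoremB (R Rh : comNzRingType) (phi : {rmorphism R -> Rh}) :
  noetherian R -> is_local R -> is_henselization phi ->
  (splinter R <-> splinter Rh).
Proof.
move=> noeth /is_localP lR hphi; split; first exact: splinter_henselization hphi.
exact: splinter_of_henselization hphi.
Qed.
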